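(* Let $L$ be a self-adjoint positive definite operator in a Hilbert space $\mathbf{H}$. For $\alpha>0$ and $1\le q\le\infty$ the norm of the Besov space $\mathcal{B}^{\alpha}_{\mathbf{H},q}(\sqrt{L})$ is equivalent to $$f\mapsto\left(\sum_{j=0}^{\infty}\left(2^{j\alpha}\left\|F_j(\sqrt{L})f\right\|_{\mathbf{H}}\right)^{q}\right)^{1/q},$$ with the standard modifications for $q=\infty$.
   Context: $\mathbf{H}^r$ is the domain of $L^{r/2}$ with norm $\|f\|_{\mathbf{H}}+\|L^{r/2}f\|_{\mathbf{H}}$. $\mathcal{B}^{\alpha}_{\mathbf{H},q}(\sqrt{L})=(\mathbf{H},\mathbf{H}^{r})^{K}_{\theta,q}$ with $0<\theta=\alpha/r<1$, $r\in\mathbb{N}$, i.e. the space of $f\in\mathbf{H}$ with finite norm $\left(\int_0^\infty(t^{-\theta}K(f,t))^q\frac{dt}{t}\right)^{1/q}$ (supremum for $q=\infty$), where $K(f,t)=\inf_{f=f_0+f_1,\ f_0\in\mathbf{H},\ f_1\in\mathbf{H}^r}(\|f_0\|_{\mathbf{H}}+t\|f_1\|_{\mathbf{H}^r})$. The functions $F_j$: let $g\in C^\infty(\mathbb{R}_+)$ be non-increasing with $\mathrm{supp}(g)\subset[0,2]$, $g=1$ on $[0,1]$, $0\le g\le1$; $h(\lambda)=g(\lambda)-g(2\lambda)$; $F_0(\lambda)=\sqrt{g(\lambda)}$, $F_j(\lambda)=\sqrt{h(2^{-j}\lambda)}$ for $j\ge1$. The operators $F_j(\sqrt{L})$ are defined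 by the spectral functional calculus of the self-adjoint operator $\sqrt{L}$ (positive square root of $L$). *)

(* Defs.v *)
From HB Require Import structures.
From mathcomp Require Import all_boot all_order all_algebra.
From mathcomp Require Import sesquilinear.
From mathcomp Require Import all_classical all_reals all_analysis.
From mathcomp Require Import complex.

Set Implicit Arguments.
Unset Strict Implicit.
Unset Printing Implicit Defensive.
Import Order.TTheory GRing.Theory Num.Theory.
Import numFieldNormedType.Exports HBSimple.
Local Open Scope classical_set_scope.
Local Open Scope complex_scope.
Local Open Scope ring_scope.

(* The inner product is linear in its first argument. *)
Record hilbert (R : realType) := Hilbert {
  hcarrier :> completeNormedModType R[i] ;
  inner : {dot hcarrier for Num.conj} ;
  innerE : forall x : hcarrier, inner x x = `|x| ^+ 2 }.

(* MathComp-Analysis norms take values in the scalar field, here R[i]. *)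
Definition hnorm (R : realType) (V : normedModType R[i]) (x : V) : R :=
  complex.Re `|x|.

Section inner_product.
Context (R : realType) (H : hilbert R).
Implicit Types x y : H.

Lemma hnormE x : `|x| = (hnorm x)%:C.
Proof. by rewrite /hnorm RRe_real// normr_real. Qed.

Lemma hnorm_ge0 x : 0 <= hnorm x.
Proof. by have := normr_ge0 x; rewrite hnormE lecR. Qed.

Lemma Re_inner x : complex.Re (inner H x x) = hnorm x ^+ 2.
Proof. by rewrite innerE hnormE -rmorphXn. Qed.

Lemma inner_CauchySchwarz x y :
  `|complex.Re (inner H x y)| <= hnorm x * hnorm y.
Proof.
have [->|y0] := eqVneq y 0.
  by rewrite linear0r/= normr0 mulr_ge0 ?hnorm_ge0.
have hy : 0 < hnorm y ^+ 2.
  rewrite exprn_gt0// lt_neqAle hnorm_ge0 andbT eq_sym.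
  by apply: contra_neq y0 => h; apply/normr0_eq0; rewrite hnormE h.
pose t : R := complex.Re (inner H x y) / hnorm y ^+ 2.
have := Re_inner (x - t%:C *: y).
rewrite dnormB dnormZ linearZr_LR/= !innerE !hnormE.
have -> : `|t%:C| = `|t|%:C by rewrite normc_def/= expr0n/= addr0 sqrtr_sqr.
set d := inner H x y; set a := hnorm x; set b := hnorm y.
rewrite -!rmorphXn -rmorphM/= real_normK ?num_real//.
have -> : complex.Re ((a ^+ 2)%:C + (t ^+ 2 * b ^+ 2)%:C -
   ((t%:C)^* * d + ((t%:C)^* * d)^*)%C) = a ^+ 2 + t ^+ 2 * b ^+ 2 - (t * complex.Re d) *+ 2.
  by case: d => u v /=; rewrite oppr0 !mul0r !subr0 mulr2n.
have tb : t * b ^+ 2 = complex.Re d by rewrite /t divfK// gt_eqF.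
move=> E; have : 0 <= a ^+ 2 + t ^+ 2 * b ^+ 2 - (t * complex.Re d) *+ 2.
  by rewrite E sqr_ge0.
rewrite expr2 -mulrA tb mulr2n opprD addrA addrK subr_ge0 => le.
rewrite -ler_sqr ?nnegrE ?mulr_ge0 ?hnorm_ge0// real_normK ?num_real//.
rewrite exprMn -ler_pdivrMr//; apply: le_trans le.
by rewrite expr2 mulrAC.
Qed.

Lemma cvg_hnormB (u : nat -> H) (l : H) :
  u @ \oo --> l -> (fun n => hnorm (u n - l)) @ \oo --> (0 : R).
Proof.
move=> ul; apply/cvgrPdist_lt => e e0.
have e0C : 0 < e%:C by rewrite ltcR.
near=> n; rewrite sub0r normrN ger0_norm ?hnorm_ge0// -ltcR -hnormE distrC.
by near: n; move/cvgrPdist_lt : ul; exact.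
Unshelve. all: by end_near. Qed.

End inner_product.

Record pvm (R : realType) (H : hilbert R) := PVM {
  proj :> set R -> {linear H -> H} ;
  pvm_idem : forall B x, measurable B -> proj B (proj B x) = proj B x ;
  pvm_sym : forall B x y, measurable B ->
    inner H (proj B x) y = inner H x (proj B y) ;
  pvm_setT : forall x, proj setT x = x ;
  pvm_sigma_additive : forall (F : nat -> set R) x,
    (forall n, measurable (F n)) -> trivIset setT F ->
    (fun n => \sum_(0 <= i < n) proj (F i) x) @ \oo
      --> proj (\bigcup_n F n) x }.

(* |E B x|^2 is <E B x, x> when B is measurable. *)
Definition spectral_mass (R : realType) (H : hilbert R) (E : pvm H) (x : H)
  (B : set (measurableTypeR R)) : \bar R := (hnorm (E B x) ^+ 2)%:E.

Section spectral_mass_measure.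
Context (R : realType) (H : hilbert R) (E : pvm H) (x : H).

Lemma spectral_mass_inner (B : set R) : measurable B ->
  hnorm (E B x) ^+ 2 = complex.Re (inner H (E B x) x).
Proof. by move=> mB; rewrite -{2}pvm_idem// pvm_sym// Re_inner. Qed.

Lemma spectral_mass0 : spectral_mass E x set0 = 0%E.
Proof.
have := @pvm_sigma_additive _ _ E (fun=> set0) x (fun=> measurable0).
move=> /(_ (@trivIset_set0 _ _ _)); set u := (fun n => _); set l := E _ x => ul.
have uS : (fun n => u n.+1 - u n) @ \oo --> l - l.
  by apply: cvgB => //; rewrite -(cvg_shiftS u) in ul.
have : (fun n => u n.+1 - u n) = fun=> E set0 x.
  by apply/funext => n; rewrite /u big_nat_recr//= addrAC subrr add0r.
move=> uE; rewrite uE subrr in uS.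
have E0 : E set0 x = 0 by apply: (cvg_unique _ (cvg_cst _) uS).
by rewrite /spectral_mass E0 /hnorm normr0/= expr0n.
Qed.

Lemma spectral_mass_ge0 B : (0 <= spectral_mass E x B)%E.
Proof. by rewrite lee_fin sqr_ge0. Qed.

Lemma spectral_mass_sigma_additive : semi_sigma_additive (spectral_mass E x).
Proof.
move=> F mF tF mUF.
have := @pvm_sigma_additive _ _ E F x mF tF.
set u := (fun n => _); set l := E _ x => /cvg_hnormB ul.
pose a n : R := \sum_(0 <= i < n) hnorm (E (F i) x) ^+ 2.
rewrite (_ : (fun n => _) = EFin \o a); last first.
  by apply/funext => n; rewrite /= sumEFin.
apply/cvg_EFin; first by near=> n.
rewrite /spectral_mass/= spectral_mass_inner// -/l.
have aE n : a n = complex.Re (inner H (u n) x).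
  rewrite /a /u linear_sumlz raddf_sum/=.
  by apply: eq_bigr => i _; exact: spectral_mass_inner (mF i).
have ulx : (fun n => hnorm (u n - l) * hnorm x) @ \oo --> (0 : R).
  by rewrite -[X in _ --> X](mul0r (hnorm x)); apply: cvgMl.
have cv : (fun n => `|a n - complex.Re (inner H l x)|) @ \oo --> (0 : R).
  apply: (@squeeze_cvgr nat \oo _ R (fun=> 0) _ _ _ 0 (cvg_cst _) ulx).
  near=> n; rewrite normr_ge0/= aE -raddfB/= -linearBl.
  exact: inner_CauchySchwarz.
exact: (proj1 (subr_cvg0 a _) (norm_cvg0 cv)).
Unshelve. all: by end_near. Qed.

HB.instance Definition _ := isMeasure.Build _ _ _ (spectral_mass E x)
  spectral_mass0 spectral_mass_ge0 spectral_mass_sigma_additive.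

End spectral_mass_measure.


Definition sfun_integral (R : realType) (H : hilbert R) (E : pvm H)
    (s : {sfun (measurableTypeR R) >-> R}) (x : H) : H :=
  \sum_(c \in range s) c%:C *: E (s @^-1` [set c]) x.

(* The image of phi under the isometry L^2(spectral_mass E x) -> H that maps
   \1_B to E B x; the junk value 0 when phi is not in that L^2 space. *)
Definition spectral_integral (R : realType) (H : hilbert R) (E : pvm H)
    (phi : R -> R) (x : H) : H :=
  xget 0 [set y | forall e : R, 0 < e ->
    exists s : {sfun (measurableTypeR R) >-> R},
      (\int[spectral_mass E x]_l ((phi l - s l) ^+ 2)%:E < e%:E)%E /\
      hnorm (y - sfun_integral E s x) < e].

Record partial_op (R : realType) (H : hilbert R) := PartialOp {
  dom : set H ;
  op_val :> H -> H }.

Section operators.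
Context (R : realType) (H : hilbert R).
Implicit Types A B : partial_op H.

Definition op_eq A B := dom A = dom B /\ forall x, dom A x -> A x = B x.

Definition linear_op A := dom A 0 /\
  forall (a : R[i]) x y, dom A x -> dom A y ->
    dom A (a *: x + y) /\ A (a *: x + y) = a *: A x + A y.

Definition adjoint A (y z : H) :=
  forall x, dom A x -> inner H (A x) y = inner H x z.

Definition self_adjoint A := [/\ linear_op A, dense (dom A) &
  forall y z, adjoint A y z <-> dom A y /\ z = A y].

Definition positive_definite A :=
  forall x, dom A x -> x != 0 -> 0 < inner H (A x) x.

Definition nonnegative A := forall x, dom A x -> 0 <= inner H (A x) x.

Definition op_pow A (n : nat) : partial_op H := {|
  dom := [set x | forall k, (k < n)%N -> dom A (iter k A x)] ;
  op_val := iter n A |}.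

Definition is_positive_sqrt A B := [/\ self_adjoint B, nonnegative B &
  op_eq (op_pow B 2) A].

Definition spectral_op (E : pvm H) (phi : R -> R) : partial_op H := {|
  dom := [set x | (\int[spectral_mass E x]_l (phi l ^+ 2)%:E < +oo)%E] ;
  op_val := spectral_integral E phi |}.

Definition is_spectral_measure A (E : pvm H) := op_eq A (spectral_op E id).

Definition graph_norm A (x : H) : R := hnorm x + hnorm (A x).

Definition K_functional A (f : H) (t : R) : R :=
  inf [set k | exists f0 f1 : H, [/\ f = f0 + f1, dom A f1 &
    k = hnorm f0 + t * graph_norm A f1]].

(* The norm of (H, dom A)_{theta,q}; it is +oo outside of that space. *)
Definition interp_norm A (theta : R) (q : \bar R) (f : H) : \bar R :=
  match q with
  | p%:E => poweR
      (\int[lebesgue_measure]_(t in `]0%R, +oo[%classic)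
        (((t `^ (- theta) * K_functional A f t) `^ p / t)%R%:E))%E p^-1
  | +oo%E => ereal_sup
       [set (t `^ (- theta) * K_functional A f t)%:E | t in `]0, +oo[]
  | -oo%E => 0%E
  end.

(* S stands for the square root of L, so that L^{r/2} is S^r. *)
Definition besov_norm (S : partial_op H) (r : nat) (alpha : R) (q : \bar R)
    (f : H) : \bar R :=
  interp_norm (op_pow S r) (alpha / r%:R) q f.

End operators.

Definition lq_norm (R : realType) (q : \bar R) (u : nat -> R) : \bar R :=
  match q with
  | p%:E => poweR (\sum_(0 <= j <oo) (`|u j| `^ p)%R%:E)%E p^-1
  | +oo%E => ereal_sup (range (fun j => `|u j|%:E))
  | -oo%E => 0%E
  end.

(* Only the values of g on [0, +oo[ matter. Smoothness up to 0 follows from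
   smoothness on ]0, +oo[ because g = 1 on [0, 1]. *)
Definition cutoff (R : realType) (g : R -> R) := [/\
  (forall n (x : R), 0 < x -> derivable (derive1n n g) x 1),
  (forall x y : R, 0 <= x -> x <= y -> g y <= g x),
  closure [set x : R | 0 <= x /\ g x != 0] `<=` `[0, 2],
  (forall x : R, 0 <= x <= 1 -> g x = 1) &
  (forall x : R, 0 <= x -> 0 <= g x <= 1)].

(* F_j, extended by 0 to the negative half-line, which is a null set for the
   spectral measure of a nonnegative operator. *)
Definition LP_fun (R : realType) (g : R -> R) (j : nat) : R -> R :=
  (fun l : R => if j is 0 then Num.sqrt (g l)
    else let h m := g m - g (2 * m) in Num.sqrt (h (2 ^- j * l)))
  \_ `[0, +oo[.

(* Main.v *)
Require Import Defs.
From mathcomp Require Import all_boot all_order all_algebra.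
From mathcomp Require Import sesquilinear.
From mathcomp Require Import all_classical all_reals all_analysis.
From mathcomp Require Import measurable_realfun complex finmap lra ring.

(** Write [mu] for the spectral mass of [f], [D_0 = [0, 1]], [D_k = ]2^(k-1), 2^k]],
    [d_k] for the norm of [E(D_k) f], [a_k] for that of [F_k(S) f], [S] being the
    square root of [L], and [rho = 2^r], [lam = 2^alpha], so that
    [1 < lam < rho].

    The functional calculus is isometric, so [a_k^2] is the integral of [F_k^2]
    against [mu] ([hnorm_LP]). Since [F_k^2] is at most 1 and lives on
    [D_k] and [D_(k+1)], while [F_k^2 + F_(k+1)^2 = 1] on [D_(k+1)], the sequences
    [a] and [d] control each other up to a shift of the index: smooth cut-offs may
    be replaced by sharp spectral projections ([LP_le_dyadic], [dyadic_le_LP]).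

    For sharp projections both bounds for the K-functional are elementary. On
    [D_k] the operator [S^r] is of size [rho^k]: hence [d_k] is at most a multiple
    of [K(f, t)] as soon as [t rho^k] is bounded below ([dyadic_le_K]), while
    cutting the spectrum at [2^j] shows that [K(f, rho^-j)] is at most
    the norm of the tail beyond [2^j] plus twice the sum of [rho^(k-j) d_k] over
    [k <= j] ([K_le_dyadic]). The tail tends to zero because the nonnegative
    operator [S] has no spectral mass on the negative half-line
    ([pvm_negative]).

    With the weight [lam^j], the two parts of the last bound are convolutions of
    [lam^k d_k] with the geometric kernels of ratios [lam^-1] and [lam / rho].
    A discrete Hardy inequality, obtained from the two-point convexity of the power
    function by absorption, bounds them in l^q by [lam^k d_k] ([lq_le_K_dyadic]).

    Finally the interpolation norm is compared with the l^q norm of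
    [lam^j K(f, rho^-j)] by cutting the half-line of [t] at the powers of [rho];
    for [t >= 1] the functional is constant, as the graph norm dominates the norm,
    and [t^-theta] decays geometrically ([interp_norm_le], [interp_norm_ge]). *)

Set Implicit Arguments.
Unset Strict Implicit.
Unset Printing Implicit Defensive.
Import Order.TTheory GRing.Theory Num.Theory.
Import numFieldNormedType.Exports HBSimple HBNNSimple.
Local Open Scope classical_set_scope.
Local Open Scope complex_scope.
Local Open Scope ring_scope.

(** * Norms and spectral projections *)

Section hilbert_norm.
Context (R : realType) (H : hilbert R).
Implicit Types x y : H.

Lemma hnorm0 : hnorm (0 : H) = 0.
Proof. by rewrite /hnorm normr0. Qed.

Lemma hnorm_oppr x : hnorm (- x) = hnorm x.
Proof. by rewrite /hnorm normrN. Qed.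

Lemma hnormBC x y : hnorm (x - y) = hnorm (y - x).
Proof. by rewrite -hnorm_oppr opprB. Qed.

Lemma hnorm_eq0 x : hnorm x = 0 -> x = 0.
Proof. by move=> h; apply: normr0_eq0; rewrite hnormE h. Qed.

Lemma hnormZ (c : R) x : hnorm (c%:C *: x) = `|c| * hnorm x.
Proof.
apply: (@complexI R); rewrite -hnormE normrZ hnormE rmorphM; congr (_ * _).
by rewrite normc_def/= expr0n/= addr0 sqrtr_sqr.
Qed.

Lemma ler_hnormD x y : hnorm (x + y) <= hnorm x + hnorm y.
Proof. by rewrite -lecR rmorphD/= -!hnormE ler_normD. Qed.

Lemma hnorm_sum (I : Type) (r : seq I) (P : pred I) (F : I -> H) :
  hnorm (\sum_(i <- r | P i) F i) <= \sum_(i <- r | P i) hnorm (F i).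
Proof.
elim/big_rec2 : _ => [|i y1 y2 _ h]; first by rewrite hnorm0.
by rewrite (le_trans (ler_hnormD _ _))// lerD2l.
Qed.

Lemma hnormB_dist x y : `|hnorm x - hnorm y| <= hnorm (x - y).
Proof.
rewrite ler_norml; apply/andP; split.
  rewrite lerNl opprB lerBlDl -(hnorm_oppr (x - y)) opprB.
  by rewrite (le_trans _ (ler_hnormD _ _))// addrCA subrr addr0.
by rewrite lerBlDl (le_trans _ (ler_hnormD _ _))// addrCA subrr addr0.
Qed.

Lemma cvg_hnorm (u : nat -> H) (l : H) :
  (fun n => hnorm (u n - l)) @ \oo --> (0 : R) ->
  (fun n => hnorm (u n)) @ \oo --> hnorm l.
Proof.
move=> h; apply/subr_cvg0; apply: norm_cvg0.
apply: (@squeeze_cvgr nat \oo _ R (fun=> 0) _ _ _ 0 (cvg_cst _) h).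
by near=> n; rewrite normr_ge0/= hnormB_dist.
Unshelve. all: by end_near. Qed.

Lemma Re_innerC x y : complex.Re (inner H x y) = complex.Re (inner H y x).
Proof. by rewrite hermC/= expr0 mul1r; case: (inner H y x : R[i]) => a b /=. Qed.

Lemma hnorm_sqD x y :
  hnorm (x + y) ^+ 2 = hnorm x ^+ 2 + hnorm y ^+ 2 + 2 * complex.Re (inner H x y).
Proof.
rewrite -!Re_inner linearDl/= !linearDr/= !raddfD/= (Re_innerC y x).
ring.
Qed.

End hilbert_norm.

Section projection_valued_measure.
Context (R : realType) (H : hilbert R) (E : pvm H).
Implicit Types (B C : set R) (x y : H).

Lemma pvm_set0 x : E set0 x = 0.
Proof.
apply: hnorm_eq0; apply/eqP; rewrite -sqrf_eq0; apply/eqP.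
by have := spectral_mass0 E x; rewrite /spectral_mass => -[].
Qed.

Lemma pvm_massU B C x : measurable B -> measurable C -> [disjoint B & C] ->
  hnorm (E (B `|` C) x) ^+ 2 = hnorm (E B x) ^+ 2 + hnorm (E C x) ^+ 2.
Proof.
move=> mB mC BC; apply: EFin_inj; rewrite EFinD.
exact: (@measureU _ _ _ (spectral_mass E x) B C mB mC (eqP BC)).
Qed.

Lemma pvmU B C x : measurable B -> measurable C -> [disjoint B & C] ->
  E (B `|` C) x = E B x + E C x.
Proof.
move=> mB mC; rewrite disj_set2E => /eqP BC.
have := @pvm_sigma_additive _ _ E (bigcup2 B C) x.
rewrite bigcup2E => h.
have {}h : (fun n => \sum_(0 <= i < n) E (bigcup2 B C i) x) @ \oo -->
    E (B `|` C) x.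
  apply: h => [[|[|n]]//|]; first exact: measurable0.
  by move=> [|[|i]] [|[|j]] _ _ /=; rewrite ?set0I ?setI0// ?BC => -[]//;
    move=> z; rewrite /bigcup2/= => zz; have : (B `&` C) z by [split; case: zz];
    rewrite BC.
rewrite -(cvg_shiftn 2) in h.
have hE : (fun n => \sum_(0 <= i < n + 2) E (bigcup2 B C i) x) =
    (fun=> E B x + E C x).
  apply/funext => n; rewrite addn2 big_nat_recl// big_nat_recl//= big1 ?addr0//.
  by move=> i _; rewrite pvm_set0.
rewrite hE in h; exact: (cvg_unique _ h (cvg_cst _)).
Qed.

Lemma pvm_contract B x : measurable B -> hnorm (E B x) <= hnorm x.
Proof.
move=> mB; rewrite -(@ler_pXn2r _ 2)// ?nnegrE ?hnorm_ge0//.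
rewrite -{2}(pvm_setT E x) -(setUv B) pvm_massU//; last first.
- by rewrite disj_set2E setICr.
- exact: measurableC.
by rewrite lerDl sqr_ge0.
Qed.

(** Comparing the mass that [E C x] gives to [B `|` C] with its total mass
    leaves no room for a component in the range of [E B]. *)
Lemma pvm_disjoint B C x : measurable B -> measurable C -> [disjoint B & C] ->
  E B (E C x) = 0.
Proof.
move=> mB mC BC; apply: hnorm_eq0; apply/eqP; rewrite -sqrf_eq0 eq_le sqr_ge0.
rewrite andbT -(lerD2r (hnorm (E C (E C x)) ^+ 2)) -pvm_massU// add0r pvm_idem//.
rewrite ler_pXn2r ?nnegrE ?hnorm_ge0//.
by apply: pvm_contract; exact: measurableU.
Qed.

(** Cutting both sets along their intersection leaves only products of
    projections onto disjoint sets besides the diagonal term. *)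
Lemma pvmI B C x : measurable B -> measurable C -> E B (E C x) = E (B `&` C) x.
Proof.
move=> mB mC.
have mBC : measurable (B `&` C) by exact: measurableI.
have mCB : measurable (C `\` B) by exact: measurableD.
have mBDC : measurable (B `\` C) by exact: measurableD.
have d1 : [disjoint B `&` C & C `\` B].
  by rewrite disj_set2E; apply/eqP/seteqP; split => // z /= [[? ?] []].
have d2 : [disjoint B `&` C & B `\` C].
  by rewrite disj_set2E; apply/eqP/seteqP; split => // z /= [[? ?] []].
have -> : E C x = E (B `&` C) x + E (C `\` B) x.
  rewrite -pvmU//; congr (E _ x).
  by apply/seteqP; split=> z /=; [case: (pselect (B z)); tauto|tauto].
rewrite linearD/= [X in _ + X]pvm_disjoint// ?addr0; last first.
  by rewrite disj_set2E; apply/eqP/seteqP; split => // z /= [? []].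
have {1}-> : B = (B `&` C) `|` (B `\` C).
  by apply/seteqP; split=> z /=; [move=> ?; case: (pselect (C z)); tauto|tauto].
rewrite pvmU// pvm_idem// pvm_disjoint ?addr0//.
by rewrite disj_set2E setIC -disj_set2E.
Qed.

Lemma pvm_inner_disjoint B C x y : measurable B -> measurable C ->
  [disjoint B & C] -> inner H (E B x) (E C y) = 0.
Proof. by move=> mB mC BC; rewrite pvm_sym// pvm_disjoint// linear0r. Qed.

Lemma pvm_pythagoras (I : eqType) (r : seq I) (c : I -> R) (B : I -> set R) x :
  uniq r -> (forall i, measurable (B i)) ->
  (forall i j, i != j -> [disjoint B i & B j]) ->
  hnorm (\sum_(i <- r) (c i)%:C *: E (B i) x) ^+ 2 =
  \sum_(i <- r) c i ^+ 2 * hnorm (E (B i) x) ^+ 2.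
Proof.
move=> ur mB dB; elim: r ur => [|i r IH] /=.
  by rewrite !big_nil hnorm0 expr0n.
move=> /andP[ir ur]; rewrite !big_cons hnorm_sqD hnormZ exprMn IH//.
rewrite real_normK ?num_real// linear_sumr raddf_sum/= [X in 2 * X]big1_seq ?mulr0 ?addr0//.
move=> j /andP[_ jr]; rewrite linearZl/= linearZr/= pvm_inner_disjoint//.
  by rewrite !mulr0.
by apply: dB; apply: contraNneq ir => ->.
Qed.

(** Splits a projection along a finite partition of its set; applied to the
    fibres of a second simple function it yields a common refinement. *)
Lemma pvm_partition (I : eqType) (r : seq I) (B : I -> set R) C x :
  uniq r -> measurable C -> (forall i, measurable (B i)) ->
  (forall i j, i != j -> [disjoint B i & B j]) ->
  (forall l, C l -> exists2 i, i \in r & B i l) ->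
  E C x = \sum_(i <- r) E (C `&` B i) x.
Proof.
move=> ur mC mB dB; elim: r ur C mC => [|i r IH] /= ur C mC CB.
  rewrite big_nil (_ : C = set0) ?pvm_set0//.
  by apply/seteqP; split => // l /CB[].
move: ur => /andP[ir ur].
have mD : measurable (C `\` B i) by exact: measurableD.
have mI : measurable (C `&` B i) by exact: measurableI.
rewrite big_cons -{1}(setUIDK C (B i)) pvmU//; last first.
  by rewrite disj_set2E; apply/eqP/seteqP; split => // z /= [[_ ?] [_]].
congr (_ + _); rewrite (IH ur _ mD).
  apply: eq_big_seq => j jr; congr (E _ x).
  have /dB : i != j by apply: contraNneq ir => ->.
  rewrite disj_set2E => /eqP/seteqP[/= Bij _].
  by apply/seteqP; split => l /=; have := Bij l; rewrite /=; tauto.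
move=> l [/= Cl nB]; have [j] := CB _ Cl; rewrite inE => /orP[/eqP ->//|jr Bj].
by exists j.
Qed.

End projection_valued_measure.

(** * The calculus of simple functions *)

Section sfun_integral.
Context (R : realType) (H : hilbert R) (E : pvm H).
Implicit Types (s t : {sfun (measurableTypeR R) >-> R}) (B : set R) (x : H).

Let fibre s t (p : R * R) : set R := s @^-1` [set p.1] `&` t @^-1` [set p.2].

Let measurable_preim s (c : R) : measurable (s @^-1` [set c] : set R).
Proof. exact: (measurable_funPTI s (measurable_set1 c)). Qed.

Let measurable_fibre s t p : measurable (fibre s t p).
Proof. exact: measurableI. Qed.

Let disjoint_fibre s t p p' : p != p' -> [disjoint fibre s t p & fibre s t p'].
Proof.
move=> pp'; rewrite disj_set2E; apply/eqP/seteqP; split => // l [[/= a b] [/= c d]].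
by move/eqP: pp'; apply; case: p p' a b c d => ? ? [? ?]/= -> -> -> ->.
Qed.

Let values s t : seq (R * R) :=
  [seq (c, d) | c <- fset_set (range s), d <- fset_set (range t)].

Let values_uniq s t : uniq (values s t).
Proof.
by apply: allpairs_uniq => [||[? ?] [? ?]//]; exact: finmap.fset_uniq.
Qed.

Let mem_range s l : s l \in fset_set (range s).
Proof. by rewrite in_fset_set//; apply/mem_set; exists l. Qed.

Let mem_values s t l : (s l, t l) \in values s t.
Proof. by apply: allpairs_f; exact: mem_range. Qed.

Let sfun_integralE s x :
  sfun_integral E s x = \sum_(c <- fset_set (range s)) c%:C *: E (s @^-1` [set c]) x.
Proof. by rewrite /sfun_integral fsbig_finite. Qed.

Let pvm_preim s t x c :
  E (s @^-1` [set c]) x = \sum_(d <- fset_set (range t)) E (fibre s t (c, d)) x.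
Proof.
apply: (@pvm_partition _ _ E _ _ (fun d => t @^-1` [set d])) => //; first exact: finmap.fset_uniq.
- move=> i j ij; rewrite disj_set2E; apply/eqP/seteqP; split => // l [/= a b].
  by move/eqP: ij; rewrite -a -b.
- by move=> l _; exists (t l) => //; exact: mem_range.
Qed.

(** Two simple functions are constant on the common refinement of their
    fibres. *)
Let sfun_integralB s t x : sfun_integral E s x - sfun_integral E t x =
  \sum_(p <- values s t) (p.1 - p.2)%:C *: E (fibre s t p) x.
Proof.
rewrite !sfun_integralE big_allpairs_dep/=.
under eq_bigr do rewrite (pvm_preim s t) scaler_sumr.
under [X in _ - X]eq_bigr do rewrite (pvm_preim t s) scaler_sumr.
rewrite [X in _ - X]exchange_big/= -sumrB; apply: eq_bigr => c _.
rewrite -sumrB; apply: eq_bigr => d _.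
by rewrite /fibre/= [X in _ - _ *: E X _]setIC -scalerBl rmorphB.
Qed.

(** By Pythagoras over the common refinement, the calculus of simple functions
    is isometric; keeping the projection [E B] outside the difference makes the
    same identity give the spectral mass of the image on every set [B]. *)
Lemma hnorm_sfun_integralB s t B x : measurable B ->
  ((hnorm (E B (sfun_integral E s x - sfun_integral E t x)) ^+ 2)%:E =
   \int[spectral_mass E x]_(l in B) ((s l - t l) ^+ 2)%:E)%E.
Proof.
move=> mB; rewrite sfun_integralB linear_sum/=.
under eq_bigr do rewrite linearZ/= pvmI//.
rewrite (@pvm_pythagoras _ _ E _ _ (fun p => p.1 - p.2)
  (fun p => B `&` fibre s t p))//; last 2 first.
- by move=> p; exact: measurableI.
- move=> p p' /(disjoint_fibre s t); rewrite !disj_set2E => /eqP/seteqP[/= pp' _].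
  by apply/eqP/seteqP; split => // l /= [[_ ?] [_ ?]]; apply: (pp' l).
rewrite -sumEFin (_ : (fun l => _) = (fun l : measurableTypeR R =>
  \sum_(p <- values s t) ((p.1 - p.2) ^+ 2)%:E * (\1_(fibre s t p) l)%:E)%E); last first.
  apply/funext => l; rewrite (bigD1_seq (s l, t l))//= big1 ?adde0.
    by rewrite indicE mem_set// mule1.
  move=> p /eqP pl; rewrite indicE memNset ?mule0// => -[/= a b].
  by apply: pl; rewrite a b; case: p {a b}.
rewrite ge0_integral_sum//; last 2 first.
- move=> p; apply: emeasurable_funM => //; apply/measurable_EFinP.
  apply: measurable_indic; exact: measurable_fibre.
- by move=> p l _; rewrite mule_ge0// lee_fin ?sqr_ge0.
apply: eq_bigr => p _; rewrite ge0_integralZl_EFin//; last 2 first.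
- apply/measurable_EFinP; apply: measurable_indic; exact: measurable_fibre.
- by rewrite sqr_ge0.
rewrite integral_indic//; last exact: measurable_fibre.
by rewrite setIC.
Qed.

End sfun_integral.

(** * The isometry of the functional calculus *)

Section spectral_integral.
Context (R : realType) (H : hilbert R) (E : pvm H).
Implicit Types (s t : {sfun (measurableTypeR R) >-> R}) (B : set R) (x : H).
Local Notation mu := (spectral_mass E).

(** Approximating the positive and the negative part from below keeps the
    approximants under [`|phi|], as dominated convergence requires. *)
Lemma sfun_approximation (phi : measurableTypeR R -> R) :
  measurable_fun setT phi ->
  exists u : nat -> {sfun (measurableTypeR R) >-> R},
    (forall n l, `|u n l| <= `|phi l|) /\
    (forall l, (fun n => u n l) @ \oo --> phi l).
Proof.
move=> mphi; pose f := EFin \o phi.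
have mf : measurable_fun [set: measurableTypeR R] f by exact/measurable_EFinP.
have mp := measurable_funepos mf; have mn := measurable_funeneg mf.
pose p_ := nnsfun_approx measurableT mp.
pose n_ := nnsfun_approx measurableT mn.
have cp l : (fun n => (p_ n l)%:E) @ \oo --> (f^\+ l)%E.
  exact: (@cvg_nnsfun_approx _ _ _ _ measurableT _ mp (fun l _ => funepos_ge0 f l)).
have cn l : (fun n => (n_ n l)%:E) @ \oo --> (f^\- l)%E.
  exact: (@cvg_nnsfun_approx _ _ _ _ measurableT _ mn (fun l _ => funeneg_ge0 f l)).
exists (fun n => p_ n \+ cst (-1) \* n_ n); split.
  move=> n l /=.
  have pn : ((p_ n l)%:E <= f^\+ l)%E.
    by rewrite /p_ nnsfun_approxE; apply: le_approx.
  have nn : ((n_ n l)%:E <= f^\- l)%E.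
    by rewrite /n_ nnsfun_approxE; apply: le_approx.
  have p0 : 0 <= p_ n l by exact: fun_ge0.
  have n0 : 0 <= n_ n l by exact: fun_ge0.
  move: pn nn; rewrite /f funeposE funenegE/= -!EFin_max !lee_fin.
  rewrite !le_max mulN1r => a b; rewrite ler_norml; apply/andP.
  by case: (ger0P (phi l)) => f0; move: a b => /orP[a|a] /orP[b|b]; split; lra.
move=> l /=.
have := cp l; have := cn l; rewrite /f funeposE funenegE/= -!EFin_max.
move=> /fine_cvg hn /fine_cvg hp.
rewrite (_ : phi l = Num.max (phi l) 0 + -1 * Num.max (- phi l) 0).
  by apply: cvgD => //; apply: cvgM => //; exact: cvg_cst.
by rewrite !maxEle; case: (ltgtP (phi l) 0) => // h;
  do ?case: ifP => ?; lra.
Qed.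

Lemma sfun_integral_cst c x : sfun_integral E (cst c) x = c%:C *: x.
Proof.
rewrite /sfun_integral (_ : range _ = [set c]).
  rewrite fsbig_set1 (_ : _ @^-1` _ = setT) ?pvm_setT//.
  by apply/seteqP; split.
by apply/seteqP; split=> [_ [l _ <-]//|_ ->]; exists 0.
Qed.

Lemma hnorm_sfun_integral s B x : measurable B ->
  ((hnorm (E B (sfun_integral E s x)) ^+ 2)%:E =
   \int[mu x]_(l in B) ((s l) ^+ 2)%:E)%E.
Proof.
move=> mB; have := hnorm_sfun_integralB E s (cst 0) x mB.
rewrite sfun_integral_cst scale0r subr0 => ->.
by apply: eq_integral => l _; rewrite subr0.
Qed.

Lemma sfun_sqr_integrable s x : (mu x).-integrable setT (fun l => (s l ^+ 2)%:E).
Proof.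
apply/integrableP; split.
  by apply/measurable_EFinP; apply: measurable_funX.
under eq_integral do rewrite gee0_abs ?lee_fin ?sqr_ge0//.
by rewrite -hnorm_sfun_integral// ltry.
Qed.

Section square_integrable.
Variables (phi : measurableTypeR R -> R) (x : H).
Hypothesis mphi : measurable_fun setT phi.
Hypothesis phi2 : (\int[mu x]_l (phi l ^+ 2)%:E < +oo)%E.

Let mu_measurable (f : measurableTypeR R -> R) D : measurable_fun setT f ->
  measurable_fun D (fun l => (f l ^+ 2)%:E).
Proof.
move=> mf; apply/measurable_EFinP; apply: measurable_funX.
exact: measurable_funTS.
Qed.

Let phi2_integrable : (mu x).-integrable setT (fun l => (phi l ^+ 2)%:E).
Proof.
apply/integrableP; split; first exact: mu_measurable.
by under eq_integral do rewrite gee0_abs ?lee_fin ?sqr_ge0//.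
Qed.

(** The isometry combined with [(x + y)^2 <= 2 x^2 + 2 y^2]: two simple functions
    that are both close to [phi] in L^2 have close images. This yields both the
    Cauchy property of approximants and the independence of their choice. *)
Lemma hnorm_sfun_integralB_le s t :
  ((hnorm (sfun_integral E s x - sfun_integral E t x) ^+ 2)%:E <=
   2%:E * \int[mu x]_l ((phi l - s l) ^+ 2)%:E +
   2%:E * \int[mu x]_l ((phi l - t l) ^+ 2)%:E)%E.
Proof.
rewrite -(pvm_setT E (_ - _)) hnorm_sfun_integralB//.
have md u : measurable_fun setT (fun l => phi l - (u : {sfun _ >-> _}) l).
  exact: measurable_funB.
have dbl (u : {sfun (measurableTypeR R) >-> R}) :
    (2%:E * \int[mu x]_l ((phi l - u l) ^+ 2)%:E =
     \int[mu x]_l (2 * (phi l - u l) ^+ 2)%:E)%E.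
  under [RHS]eq_integral do rewrite EFinM.
  by rewrite ge0_integralZl_EFin//; [move=> l _; rewrite lee_fin sqr_ge0|
    exact: mu_measurable].
rewrite !dbl -ge0_integralD//.
- apply: ge0_le_integral => //.
  + by move=> l _; rewrite lee_fin sqr_ge0.
  + by apply: mu_measurable; exact: measurable_funB.
  + apply: emeasurable_funD; apply/measurable_EFinP; apply: measurable_funM => //;
      exact: measurable_funX.
  + by move=> l _; rewrite -EFinD lee_fin; have := sqr_ge0 (phi l - s l + (phi l - t l)); nra.
- by move=> l _; rewrite lee_fin mulr_ge0// sqr_ge0.
- by apply/measurable_EFinP; apply: measurable_funM => //; exact: measurable_funX.
- by move=> l _; rewrite lee_fin mulr_ge0// sqr_ge0.
- by apply/measurable_EFinP; apply: measurable_funM => //; exact: measurable_funX.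
Qed.

Section approximants.
Variables (u : nat -> {sfun (measurableTypeR R) >-> R}).
Hypothesis u_le : forall n l, `|u n l| <= `|phi l|.
Hypothesis u_cvg : forall l, (fun n => u n l) @ \oo --> phi l.

(* Both integrands below are dominated by multiples of phi^2 and t^2, since
   the approximants stay below phi in absolute value. *)
Let dominated t B : measurable B ->
  (fun n => \int[mu x]_(l in B) ((u n l - t l) ^+ 2)%:E)%E @ \oo -->
  (\int[mu x]_(l in B) ((phi l - t l) ^+ 2)%:E)%E.
Proof.
move=> mB.
have ig : (mu x).-integrable B (fun l => 2%:E * (phi l ^+ 2)%:E + 2%:E * (t l ^+ 2)%:E)%E.
  apply: (integrableS measurableT) => //; apply: integrableD => //.
    exact: integrableZl.
  by apply: integrableZl => //; exact: sfun_sqr_integrable.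
have [||||_ _] := @dominated_convergence _ _ _ (mu x) B mB
  (fun n l => ((u n l - t l) ^+ 2)%:E) (fun l => ((phi l - t l) ^+ 2)%:E) _ _ _ _ ig.
- by move=> n; apply: mu_measurable; exact: measurable_funB.
- by apply: mu_measurable; exact: measurable_funB.
- apply: aeW => l _; apply: cvg_EFin; first by near=> n.
  by apply: cvgM; apply: cvgB => //; exact: cvg_cst.
- apply: aeW => l n _; rewrite gee0_abs ?lee_fin ?sqr_ge0//.
  rewrite /=.
  have h : u n l ^+ 2 <= phi l ^+ 2.
    by rewrite -(real_normK (num_real (u n l))) -(real_normK (num_real (phi l))) lerXn2r ?nnegrE.
  by have := sqr_ge0 (u n l + t l); nra.
- exact.
Unshelve. all: by end_near. Qed.

Let error_cvg :
  (fun n => \int[mu x]_l ((phi l - u n l) ^+ 2)%:E)%E @ \oo --> 0%E.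
Proof.
have ig : (mu x).-integrable setT (fun l => 4%:E * (phi l ^+ 2)%:E)%E.
  exact: integrableZl.
have [||||_ _] := @dominated_convergence _ _ _ (mu x) setT measurableT
  (fun n l => ((phi l - u n l) ^+ 2)%:E) (cst 0%E) _ _ _ _ ig.
- by move=> n; apply: mu_measurable; exact: measurable_funB.
- exact: measurable_cst.
- apply: aeW => l _; apply: cvg_EFin; first by near=> n.
  rewrite -[X in _ --> X](mulr0 (0 : R)) -(subrr (phi l)).
  by apply: cvgM; apply: cvgB => //; exact: cvg_cst.
- apply: aeW => l n _; rewrite gee0_abs ?lee_fin ?sqr_ge0//.
  rewrite /=.
  have h : u n l ^+ 2 <= phi l ^+ 2.
    by rewrite -(real_normK (num_real (u n l))) -(real_normK (num_real (phi l))) lerXn2r ?nnegrE.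
  by have := sqr_ge0 (phi l + u n l); nra.
- by rewrite integral0.
Unshelve. all: by end_near. Qed.

Let error_lt (e : R) : 0 < e ->
  \forall n \near \oo, (\int[mu x]_l ((phi l - u n l) ^+ 2)%:E < e%:E)%E.
Proof.
move=> e0; have := error_cvg (open_ereal_lt' (_ : 0%E < e%:E)%E).
by apply; rewrite lte_fin.
Qed.

Let close s t (e : R) :
  (\int[mu x]_l ((phi l - s l) ^+ 2)%:E < e%:E)%E ->
  (\int[mu x]_l ((phi l - t l) ^+ 2)%:E < e%:E)%E ->
  hnorm (sfun_integral E s x - sfun_integral E t x) ^+ 2 <= 4 * e.
Proof.
move=> hs ht; rewrite -lee_fin (le_trans (hnorm_sfun_integralB_le s t))//.
rewrite (_ : (4 * e)%:E = 2%:E * e%:E + 2%:E * e%:E)%E; last first.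
  by rewrite -!EFinM -EFinD; congr (_%:E); ring.
by rewrite leeD// lee_pmul2l// ltW.
Qed.

Let sfun_integral_cvg : cvg ((fun n => sfun_integral E (u n) x) @ \oo).
Proof.
apply/cauchy_cvgP; apply: (@cauchy_exP _ H) => d d0.
have [dr d1 dE] : exists2 e : R, 0 < e & d = e%:C.
  by exists (complex.Re d); [rewrite -ltcR|]; rewrite ?RRe_real// ger0_real// ltW.
have e0 : 0 < dr ^+ 2 / 5 by rewrite divr_gt0// exprn_gt0.
have := error_lt e0; move=> [N _ hN].
exists (sfun_integral E (u N) x); exists N => //= n Nn.
rewrite -ball_normE/= hnormE dE ltcR.
rewrite -(@ltr_pXn2r _ 2)// ?nnegrE ?hnorm_ge0 ?(ltW d1)//.
apply: (@le_lt_trans _ _ (4 * (dr ^+ 2 / 5))); last by lra.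
by apply: close; apply: hN => /=.
Qed.

(** The limit of the images of the approximants exists by completeness, has the
    property that defines [spectral_integral], and is the only vector with it. *)
Lemma spectral_integral_cvg :
  (fun n => hnorm (sfun_integral E (u n) x - spectral_integral E phi x)) @ \oo
    --> (0 : R).
Proof.
set y := lim ((fun n => sfun_integral E (u n) x) @ \oo).
have uy : (fun n => hnorm (sfun_integral E (u n) x - y)) @ \oo --> (0 : R).
  exact: cvg_hnormB.
have uy_lt (e : R) : 0 < e ->
    \forall n \near \oo, hnorm (sfun_integral E (u n) x - y) < e.
  by move=> e0; apply: (cvgr_lt 0 uy).
suff -> : spectral_integral E phi x = y by [].
rewrite /spectral_integral; apply: xget_unique.
  move=> e e0; near \oo => n; exists (u n); split.
    by near: n; exact: error_lt.
  by rewrite hnormBC; near: n; exact: uy_lt.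
move=> z hz; apply/eqP; rewrite -subr_eq0; apply/eqP/hnorm_eq0.
apply/eqP; rewrite eq_le hnorm_ge0 andbT; apply/ler_addgt0Pr => e e0.
(* An L^2 error d bounds the distance of the images by sqrt (4 d) <= e / 2. *)
rewrite add0r; pose d := Num.min (e / 4) ((e / 4) ^+ 2).
have d0 : 0 < d by rewrite lt_min exprn_gt0 ?divr_gt0.
have [s [hs sz]] := hz _ d0.
near \oo => n.
have hn : (\int[mu x]_l ((phi l - u n l) ^+ 2)%:E < d%:E)%E.
  by near: n; exact: error_lt.
have yn : hnorm (sfun_integral E (u n) x - y) < d by near: n; exact: uy_lt.
have sn := close hs hn.
have d1 : d <= e / 4 by rewrite ge_min lexx.
have d2 : d <= (e / 4) ^+ 2 by rewrite ge_min lexx orbT.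
have {}sn : hnorm (sfun_integral E s x - sfun_integral E (u n) x) <= e / 2.
  rewrite -(@ler_pXn2r _ 2)// ?nnegrE ?hnorm_ge0//; last by lra.
  by rewrite (le_trans sn)//; lra.
set a := sfun_integral E s x in sz sn *.
set b := sfun_integral E (u n) x in yn sn *.
have -> : z - y = (z - a) + ((a - b) + (b - y)) by rewrite addrA !subrKA.
have := ler_hnormD (z - a) ((a - b) + (b - y)); have := ler_hnormD (a - b) (b - y); lra.
Unshelve. all: by end_near. Qed.

Lemma hnorm_spectral_integral_approx t B : measurable B ->
  ((hnorm (E B (spectral_integral E phi x - sfun_integral E t x)) ^+ 2)%:E =
   \int[mu x]_(l in B) ((phi l - t l) ^+ 2)%:E)%E.
Proof.
move=> mB; suff lim_hnorm : (fun n =>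
    (hnorm (E B (sfun_integral E (u n) x - sfun_integral E t x)) ^+ 2)%:E) @ \oo -->
    (hnorm (E B (spectral_integral E phi x - sfun_integral E t x)) ^+ 2)%:E.
  have := dominated (t := t) mB; under eq_fun do rewrite -hnorm_sfun_integralB//.
  by move=> /(cvg_unique (@ereal_hausdorff R) lim_hnorm).
apply: cvg_EFin; first by near=> n.
rewrite /comp/=; set y := spectral_integral E phi x.
have h : (fun n => hnorm (E B (sfun_integral E (u n) x - sfun_integral E t x)))
    @ \oo --> hnorm (E B (y - sfun_integral E t x)).
  apply: cvg_hnorm.
  apply: (@squeeze_cvgr nat \oo _ R (fun=> 0) _ _ _ 0 (cvg_cst _) spectral_integral_cvg).
  near=> n; rewrite hnorm_ge0/= -linearB/= opprB addrA subrK.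
  exact: pvm_contract.
by apply: cvgM.
Unshelve. all: by end_near. Qed.

End approximants.

(** The functional calculus is isometric on every spectral subspace; comparing
    with a simple function [t] covers translates of [phi] by constants. *)
Lemma hnorm_spectral_integralB t B : measurable B ->
  ((hnorm (E B (spectral_integral E phi x - sfun_integral E t x)) ^+ 2)%:E =
   \int[mu x]_(l in B) ((phi l - t l) ^+ 2)%:E)%E.
Proof.
move=> mB; have [u [u1 u2]] := sfun_approximation mphi.
exact: (hnorm_spectral_integral_approx u1 u2).
Qed.

Lemma hnorm_spectral_integral B : measurable B ->
  ((hnorm (E B (spectral_integral E phi x)) ^+ 2)%:E =
   \int[mu x]_(l in B) (phi l ^+ 2)%:E)%E.
Proof.
move=> mB; have := hnorm_spectral_integralB (cst 0) mB.
rewrite sfun_integral_cst scale0r subr0 => ->.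
by apply: eq_integral => l _; rewrite subr0.
Qed.

End square_integrable.
End spectral_integral.

(** * Operators given by a spectral measure *)

Section spectral_localisation.
Context (R : realType) (H : hilbert R) (E : pvm H).
Implicit Types (B : set R) (x : H).
Local Notation mu := (spectral_mass E).

Lemma pvm_setC x B : measurable B -> x = E B x -> E (~` B) x = 0.
Proof.
move=> mB ->; apply: pvm_disjoint => //; first exact: measurableC.
by rewrite disj_set2E setICl.
Qed.

Lemma spectral_mass_setC x B : measurable B -> x = E B x -> mu x (~` B) = 0%E.
Proof. by move=> mB xB; rewrite /spectral_mass pvm_setC// hnorm0 expr0n. Qed.

(** The spectral mass of a vector in the range of [E B] sits on [B]. *)
Lemma integral_localised x B (f : measurableTypeR R -> \bar R) :
  measurable B -> x = E B x -> measurable_fun setT f -> (forall l, 0 <= f l)%E ->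
  (\int[mu x]_l f l = \int[mu x]_(l in B) f l)%E.
Proof.
move=> mB xB mf f0; have mBC := measurableC mB.
rewrite -{1}(setUv B) ge0_integral_setU//; last 2 first.
- by rewrite setUv.
- by rewrite disj_set2E setICr.
rewrite [X in (_ + X)%E]null_set_integral ?adde0//.
  exact: measurable_funTS.
exact: spectral_mass_setC.
Qed.

End spectral_localisation.

Lemma linear_op0 (R : realType) (H : hilbert R) (A : partial_op H) :
  linear_op A -> A 0 = 0.
Proof.
move=> [A0 AD]; have [_] := AD 1 0 0 A0 A0; rewrite !scale1r addr0.
by move/(congr1 (fun z => z - A 0)); rewrite subrr addrK => <-.
Qed.

Section spectral_operator.
Context (R : realType) (H : hilbert R) (E : pvm H) (S : partial_op H).
Hypotheses (S_lin : linear_op S) (S_E : is_spectral_measure S E).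
Implicit Types (B : set R) (x y : H).
Local Notation mu := (spectral_mass E).

Let sqr_ge0E (l : R) : (0 <= (l ^+ 2)%:E)%E. Proof. by rewrite lee_fin sqr_ge0. Qed.

Let measurable_sqr B : measurable_fun (B : set (measurableTypeR R))
  (fun l : measurableTypeR R => (l ^+ 2)%:E).
Proof. by apply/measurable_EFinP; apply: measurable_funX. Qed.

Let spectral_domE x : dom S x = (\int[mu x]_l (l ^+ 2)%:E < +oo)%E.
Proof. by case: S_E => -> _. Qed.

Lemma hnorm_spectral_opB t B x : dom S x -> measurable B ->
  ((hnorm (E B (S x - sfun_integral E t x)) ^+ 2)%:E =
   \int[mu x]_(l in B) ((l - t l) ^+ 2)%:E)%E.
Proof.
move=> Sx mB; case: S_E => _ ->//.
by apply: hnorm_spectral_integralB => //; rewrite -spectral_domE.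
Qed.

Lemma hnorm_spectral_op B x : dom S x -> measurable B ->
  ((hnorm (E B (S x)) ^+ 2)%:E = \int[mu x]_(l in B) (l ^+ 2)%:E)%E.
Proof.
move=> Sx mB; case: S_E => _ ->//.
by apply: hnorm_spectral_integral => //; rewrite -spectral_domE.
Qed.

Let integral_cst_mass B x (c : R) : measurable B ->
  (\int[mu x]_(l in B) (c ^+ 2)%:E = ((c * hnorm (E B x)) ^+ 2)%:E)%E.
Proof. by move=> mB; rewrite integral_cst// exprMn EFinM. Qed.

Lemma spectral_op_ge (m : R) B x : dom S x -> measurable B -> 0 <= m ->
  (forall l, B l -> m <= l) -> m * hnorm (E B x) <= hnorm (E B (S x)).
Proof.
move=> Sx mB m0 Bm.
rewrite -(@ler_pXn2r _ 2)// ?nnegrE ?mulr_ge0 ?hnorm_ge0// -lee_fin.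
rewrite hnorm_spectral_op// -integral_cst_mass//.
apply: ge0_le_integral => // l Bl; rewrite lee_fin lerXn2r ?nnegrE ?Bm//.
by rewrite (le_trans m0) ?Bm.
Qed.

Let sqr_integral_le (M : R) B x : measurable B -> 0 <= M -> x = E B x ->
  (forall l, B l -> `|l| <= M) ->
  (\int[mu x]_l (l ^+ 2)%:E <= ((M * hnorm x) ^+ 2)%:E)%E.
Proof.
move=> mB M0 xB BM; rewrite (integral_localised mB xB)// {2}xB.
rewrite -integral_cst_mass//; apply: ge0_le_integral => // l Bl.
by rewrite lee_fin -(real_normK (num_real l)) lerXn2r ?nnegrE ?BM.
Qed.

Lemma spectral_op_bounded (M : R) B x : measurable B -> 0 <= M -> x = E B x ->
  (forall l, B l -> `|l| <= M) ->
  [/\ dom S x, S x = E B (S x) & hnorm (S x) <= M * hnorm x].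
Proof.
move=> mB M0 xB BM; have le := sqr_integral_le mB M0 xB BM.
have Sx : dom S x by rewrite spectral_domE (le_lt_trans le)// ltry.
have mBC := measurableC mB.
split=> //.
  rewrite -{1}(pvm_setT E (S x)) -(setUv B) pvmU//; last first.
    by rewrite disj_set2E setICr.
  suff -> : E (~` B) (S x) = 0 by rewrite addr0.
  apply: hnorm_eq0; apply/eqP; rewrite -sqrf_eq0 -eqe hnorm_spectral_op//.
  rewrite null_set_integral//.
  exact: spectral_mass_setC.
rewrite -(@ler_pXn2r _ 2)// ?nnegrE ?mulr_ge0 ?hnorm_ge0// -lee_fin.
by rewrite -{1}(pvm_setT E (S x)) hnorm_spectral_op.
Qed.

(** Iterating the one-step bounds for [S] gives those for [S ^ r] without
    identifying [S ^ r] with the image of [l ^ r] under the calculus. *)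
Lemma op_pow_ge (m : R) B r x : dom (op_pow S r) x -> measurable B -> 0 <= m ->
  (forall l, B l -> m <= l) ->
  m ^+ r * hnorm (E B x) <= hnorm (E B (op_pow S r x)).
Proof.
move=> + mB m0 Bm; elim: r => [|r IH] Sx /=; first by rewrite expr0 mul1r.
rewrite exprS -mulrA; apply: le_trans (spectral_op_ge _ mB m0 Bm); last first.
  exact: (Sx r).
by rewrite ler_wpM2l//; apply: IH => k kr; apply: Sx; rewrite (ltn_trans kr).
Qed.

Lemma op_pow_bounded (M : R) B r x : measurable B -> 0 <= M -> x = E B x ->
  (forall l, B l -> `|l| <= M) ->
  dom (op_pow S r) x /\ hnorm (op_pow S r x) <= M ^+ r * hnorm x.
Proof.
move=> mB M0 xB BM.
suff : [/\ dom (op_pow S r) x, op_pow S r x = E B (op_pow S r x) &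
    hnorm (op_pow S r x) <= M ^+ r * hnorm x] by case.
elim: r => [|r [IH1 IH2 IH3]] /=; first by rewrite expr0 mul1r; split.
have [Sx SB Sle] := spectral_op_bounded mB M0 IH2 BM.
split=> // [k|]; first by rewrite ltnS leq_eqVlt => /orP[/eqP ->//|]; exact: IH1.
by rewrite exprS -mulrA (le_trans Sle)// ler_wpM2l.
Qed.

Lemma op_pow_linear r : linear_op (op_pow S r).
Proof.
have S00 := linear_op0 S_lin; case: S_lin => S0 SD.
split => [k _ /=|a x y].
  by rewrite (_ : iter k S 0 = 0)//; elim: k => //= k ->.
elim: r => [//|r IH] xr yr.
have [] := IH (fun k kr => xr k (ltnW kr)) (fun k kr => yr k (ltnW kr)).
move=> /= d e; have [h1 h2] := SD a _ _ (xr r (leqnn _)) (yr r (leqnn _)).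
split; last by rewrite e.
by move=> k; rewrite ltnS leq_eqVlt => /orP[/eqP ->|]; [rewrite e|exact: d].
Qed.

Lemma op_pow_sum r (I : Type) (s : seq I) (F : I -> H) :
  (forall i, dom (op_pow S r) (F i)) ->
  dom (op_pow S r) (\sum_(i <- s) F i) /\
  op_pow S r (\sum_(i <- s) F i) = \sum_(i <- s) op_pow S r (F i).
Proof.
have [d0 dD] := op_pow_linear r.
have S0 := linear_op0 (op_pow_linear r).
move=> dF; elim: s => [|i s [IH1 IH2]]; first by rewrite !big_nil.
rewrite !big_cons; have [] := dD 1 _ _ (dF i) IH1.
by rewrite !scale1r IH2.
Qed.

End spectral_operator.

(** * Nonnegative operators have nonnegative spectrum *)

Section nonnegative_spectrum.
Context (R : realType) (H : hilbert R) (E : pvm H) (S : partial_op H).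
Hypotheses (S_nonneg : nonnegative S) (S_E : is_spectral_measure S E).
Implicit Types (B : set R) (x y : H).
Local Notation mu := (spectral_mass E).

(** On the range of [E B] the vector [S x + M x] is shorter than [M x], which
    a nonnegative inner product of [S x] with [x] forbids. *)
Lemma pvm_negative_interval (m M : R) y : 0 < m -> m <= M -> E `[- M, - m]%classic y = 0.
Proof.
move=> m0 mM; set B : set R := `[- M, - m]%classic.
have mB : measurable B by exact: measurable_itv.
set x := E B y; have xB : x = E B x by rewrite pvm_idem.
have B_itv l : B l -> - M <= l <= - m by rewrite /B/= in_itv.
have M0 : 0 <= M by rewrite (le_trans _ mM)// ltW.
have BM l : B l -> `|l| <= M.
  by move=> /B_itv/andP[? ?]; rewrite ler_norml; apply/andP; split; lra.
have [Sx SB _] := spectral_op_bounded S_E mB M0 xB BM.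
have := hnorm_spectral_opB S_E (cst (- M)) Sx mB.
rewrite sfun_integral_cst linearB/= -SB linearZ/= -xB => e.
have le : hnorm (S x - (- M)%:C *: x) ^+ 2 <= ((M - m) * hnorm x) ^+ 2.
  rewrite -lee_fin e exprMn EFinM.
  have -> : (hnorm x ^+ 2)%:E = mu x B by rewrite /spectral_mass -xB.
  rewrite -integral_cst//; apply: ge0_le_integral => //.
  - by move=> l _; rewrite lee_fin sqr_ge0.
  - apply/measurable_EFinP; apply: measurable_funX; apply: measurable_funB => //.
  - move=> l /B_itv/andP[? ?]; rewrite lee_fin/= lerXn2r ?nnegrE//; lra.
have Re0 : 0 <= complex.Re (inner H (S x) x).
  by have := S_nonneg Sx; rewrite lecE => /andP[_].
move: le; rewrite -scaleNr -rmorphN opprK hnorm_sqD hnormZ.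
rewrite linearZr/=.
have -> : complex.Re ((M%:C)^* * inner H (S x) x)%C = M * complex.Re (inner H (S x) x).
  by case: (inner H (S x) x : R[i]) => a b /=; rewrite oppr0 mul0r subr0.
rewrite !exprMn real_normK ?num_real// => le.
have := sqr_ge0 (hnorm (S x)).
have p : 0 <= M * complex.Re (inner H (S x) x) by rewrite mulr_ge0//; lra.
move=> q; apply: hnorm_eq0; apply/eqP; rewrite -sqrf_eq0 eq_le sqr_ge0 andbT.
have k : 0 < M ^+ 2 - (M - m) ^+ 2 by nra.
by rewrite -(pmulr_rle0 _ k); lra.
Qed.

(** The negative half-line is a countable union of the previous intervals. *)
Lemma pvm_negative y : E `]-oo, 0[%classic y = 0.
Proof.
apply: hnorm_eq0; apply/eqP; rewrite -sqrf_eq0 -eqe; apply/eqP.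
suff : (mu y).-negligible (`]-oo, 0[%classic : set (measurableTypeR R)).
  by move/negligibleP; apply; exact: measurable_itv.
apply: (@negligibleS _ _ _ (mu y)
  (\bigcup_n `[- n.+1%:R, - n.+1%:R^-1]%classic)); last first.
  apply: negligible_bigcup => n; apply/negligibleP; first exact: measurable_itv.
  rewrite /= /spectral_mass pvm_negative_interval ?hnorm0 ?expr0n//.
  by rewrite (@le_trans _ _ 1)// ?invf_le1// ler1n.
move=> l /=; rewrite in_itv/= => l0.
have r0 : 0 < (- l)^-1 by rewrite invr_gt0 oppr_gt0.
have /archi_boundP : 0 <= - l + (- l)^-1 by lra.
move: (Num.bound _) => n hn; exists n => //=; rewrite in_itv/=.
have hS : (n%:R : R) <= n.+1%:R by rewrite ler_nat.
have inv : n.+1%:R^-1 <= - l by rewrite invf_ple ?posrE ?ltr0n ?oppr_gt0//; lra.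
rewrite lerNl lerNr inv andbT; apply: le_trans hS; apply: ltW.
by apply: le_lt_trans hn; rewrite lerDl ltW.
Qed.

End nonnegative_spectrum.

(** * The Littlewood-Paley functions and the dyadic partition *)

Section littlewood_paley.
Context (R : realType) (g : R -> R).
Hypothesis g_cutoff : cutoff g.
Implicit Types (l : R) (k : nat).

Let g_noninc x y : 0 <= x -> x <= y -> g y <= g x.
Proof. by case: g_cutoff => _ + _ _ _; apply. Qed.

Let g1 x : 0 <= x <= 1 -> g x = 1.
Proof. by case: g_cutoff => _ _ _ + _; apply. Qed.

Let g01 x : 0 <= x -> 0 <= g x <= 1.
Proof. by case: g_cutoff => _ _ _ _; apply. Qed.

Let g0 x : 2 < x -> g x = 0.
Proof.
move=> x2; apply/eqP; apply: contraPT x2 => gx.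
have x0 : 0 <= x \/ x < 0 by case: (leP 0 x); [left|right].
case: x0 => [x0|x0]; last by apply/negP; rewrite -leNgt; lra.
case: g_cutoff => _ _ supp _ _; have : `[0, 2]%classic x.
  by apply: supp; apply: subset_closure; split.
by rewrite /= in_itv/= => /andP[_]; rewrite leNgt => /negP.
Qed.

(** The [k]-th Littlewood-Paley function lives on the pieces [k] and [k.+1]. *)
Definition dyadic k : set R :=
  if k is k'.+1 then `]2 ^+ k', 2 ^+ k'.+1]%classic else `[0, 1]%classic.

Lemma measurable_dyadic k : measurable (dyadic k).
Proof. by case: k => [|k]; exact: measurable_itv. Qed.

Lemma dyadic_ge0 k l : dyadic k l -> 0 <= l.
Proof.
case: k => [|k]; rewrite /= in_itv/= => /andP[h _] //.
by apply: le_trans (ltW h); rewrite exprn_ge0.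
Qed.

Lemma dyadic_le k l : dyadic k l -> l <= 2 ^+ k.
Proof. by case: k => [|k]; rewrite /= in_itv/= => /andP[_]; rewrite ?expr0. Qed.

Lemma trivIset_dyadic : trivIset setT dyadic.
Proof.
have lt j k l : (j < k)%N -> dyadic j l -> ~ dyadic k l.
  case: k => // k jk /dyadic_le lj; rewrite /= in_itv/= => /andP[kl _].
  have : (2 : R) ^+ j <= 2 ^+ k by rewrite ler_weXn2l// ler1n.
  by move=> h; have := lt_le_trans kl lj; rewrite ltNge h.
move=> j k _ _ [l [jl kl]]; case: (ltngtP j k) => // h.
  by have := lt _ _ _ h jl.
by have := lt _ _ _ h kl.
Qed.

Lemma LP_fun_sqr k l : 0 <= l ->
  LP_fun g k l ^+ 2 =
  if k is k'.+1 then g (2 ^- k * l) - g (2 ^- k' * l) else g l.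
Proof.
move=> l0; rewrite /LP_fun patchE mem_set/=; last by rewrite /= in_itv/= l0.
case: k => [|k]; first by rewrite sqr_sqrtr//; case/andP: (g01 l0).
have p : 0 <= 2 ^- k.+1 * l by rewrite mulr_ge0// invr_ge0 exprn_ge0.
have e : 2 * (2 ^- k.+1 * l) = 2 ^- k * l.
  by rewrite mulrA exprS invfM mulrA divff// mul1r.
by rewrite e sqr_sqrtr// subr_ge0 g_noninc// -e; lra.
Qed.

Lemma LP_fun_neg k l : l < 0 -> LP_fun g k l = 0.
Proof.
by move=> l0; rewrite /LP_fun patchE memNset//= in_itv/= leNgt l0.
Qed.

Lemma LP_fun_sqr_le1 k l : LP_fun g k l ^+ 2 <= 1.
Proof.
have [l0|l0] := leP 0 l; last by rewrite LP_fun_neg// expr0n.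
have p j : 0 <= 2 ^- j * l by rewrite mulr_ge0// invr_ge0 exprn_ge0.
rewrite LP_fun_sqr//; case: k => [|k]; first by case/andP: (g01 l0).
by have /andP[_ ?] := g01 (p k.+1); have /andP[? _] := g01 (p k); lra.
Qed.

Lemma LP_fun_support k l : LP_fun g k l != 0 -> dyadic k l \/ dyadic k.+1 l.
Proof.
have [l0|l0] := leP 0 l; last by rewrite LP_fun_neg// eqxx.
rewrite -sqrf_eq0 LP_fun_sqr//; case: k => [|k] nz.
  have : l <= 2 by rewrite leNgt; apply: contra nz => /g0 ->.
  by rewrite /= !in_itv/= expr0 expr1; case: (leP l 1) => h h2; [left|right]; rewrite ?l0 ?h.
have lo : 2 ^+ k < l.
  rewrite ltNge; apply: contra nz => le; rewrite !g1 ?subrr//.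
    by rewrite mulr_ge0 ?invr_ge0 ?exprn_ge0//= ler_pdivrMl ?exprn_gt0// mulr1.
  rewrite mulr_ge0 ?invr_ge0 ?exprn_ge0//= ler_pdivrMl ?exprn_gt0// mulr1.
  by rewrite (le_trans le)// ler_weXn2l ?ler1n.
have hi : l <= 2 ^+ k.+2.
  rewrite leNgt; apply: contra nz => le; rewrite !g0 ?subrr//.
    rewrite ltr_pdivlMl ?exprn_gt0// -exprSr (lt_trans _ le)//.
    by rewrite ltr_eXn2l ?ltr1n.
  by rewrite ltr_pdivlMl ?exprn_gt0// -exprSr.
rewrite /= !in_itv/= lo hi /= andbT.
by case: (leP l (2 ^+ k.+1)) => h; [left|right].
Qed.

(** The squares telescope to [g (2^-(k+1) l) - g (2^(1-k) l)], and on this piece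
    the first argument is at most 1 and the second one exceeds 2. *)
Lemma LP_fun_sqrD k l : dyadic k.+1 l ->
  LP_fun g k l ^+ 2 + LP_fun g k.+1 l ^+ 2 = 1.
Proof.
move=> dl; have l0 := dyadic_ge0 dl; move: dl; rewrite /= in_itv/= => /andP[lo hi].
rewrite !LP_fun_sqr//.
have -> : g (2 ^- k.+1 * l) = 1.
  by rewrite g1// mulr_ge0 ?invr_ge0 ?exprn_ge0//= ler_pdivrMl ?exprn_gt0// mulr1.
case: k lo hi => [|k] lo hi.
  by rewrite expr0 invr1 mul1r addrC subrK.
rewrite (g0 (x := 2 ^- k * l)) ?subr0; first by rewrite addrC subrK.
by rewrite ltr_pdivlMl ?exprn_gt0// -exprSr.
Qed.

Lemma LP_fun_sqr0 l : dyadic 0 l -> LP_fun g 0 l ^+ 2 = 1.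
Proof.
by move=> dl; rewrite LP_fun_sqr ?(dyadic_ge0 dl)// g1//; rewrite /= in_itv in dl.
Qed.

(** Measurability comes from the monotonicity of [g] on the half-line. *)
Lemma measurable_LP_fun k :
  measurable_fun [set: measurableTypeR R] (LP_fun g k).
Proof.
pose g' x := g (Num.max x 0).
have mg : measurable_fun setT g'.
  rewrite -[g']opprK; apply: measurable_funN.
  apply: nondecreasing_measurable => // x y xy; rewrite lerN2.
  by apply: g_noninc; rewrite ?le_max ?lexx ?orbT//; case: (leP x 0); case: (leP y 0) => *; lra.
have sc (c : R) : measurable_fun setT (fun l => g' (c * l)).
  by apply: measurableT_comp => //; exact: measurable_funM.
pose F l : R := Num.sqrt
  (if k is k'.+1 then g' (2 ^- k * l) - g' (2 * (2 ^- k * l)) else g' l).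
have mF : measurable_fun setT F.
  apply: (@measurableT_comp _ _ _ _ _ _ (@Num.sqrt R)).
    by apply: continuous_measurable_fun; exact: sqrt_continuous.
  case: (k) => [|k']//; apply: measurable_funB => //.
  under eq_fun do rewrite mulrA; exact: sc.
have mD : measurable (`[0, +oo[%classic : set R) by exact: measurable_itv.
rewrite (_ : LP_fun g k = F \_ `[0, +oo[).
  by have := (measurable_restrictT F mD).1 (measurable_funTS mF).
apply/funext => l; rewrite /LP_fun !patchE; case: ifPn => // /set_mem/=.
rewrite in_itv/= andbT => l0.
have p j : 0 <= 2 ^- j * l by rewrite mulr_ge0// invr_ge0 exprn_ge0.
by rewrite /F; case: (k) => [|k']; rewrite /g' !max_l ?mulr_ge0.
Qed.

End littlewood_paley.
Arguments dyadic R k : clear implicits, simpl never.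

(** * Smooth and sharp dyadic pieces *)

Section dyadic_pieces.
Context (R : realType) (H : hilbert R) (E : pvm H) (g : R -> R).
Hypothesis g_cutoff : cutoff g.
Implicit Types (f : H) (k : nat).
Local Notation mu := (spectral_mass E).
Local Notation a_ k f := (hnorm (spectral_op E (LP_fun g k) f)).

Let LP_sqr_ge0 k (l : R) : (0 <= (LP_fun g k l ^+ 2)%:E)%E.
Proof. by rewrite lee_fin sqr_ge0. Qed.

Let measurable_LP_sqr k B : measurable_fun B
  (fun l : measurableTypeR R => (LP_fun g k l ^+ 2)%:E).
Proof.
apply/measurable_EFinP; apply: measurable_funX; apply: measurable_funTS.
exact: measurable_LP_fun.
Qed.

Lemma hnorm_LP k f :
  ((a_ k f ^+ 2)%:E = \int[mu f]_l (LP_fun g k l ^+ 2)%:E)%E.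
Proof.
rewrite -(pvm_setT E (spectral_op _ _ _)) hnorm_spectral_integral//.
  exact: measurable_LP_fun.
apply: (@le_lt_trans _ _ (\int[mu f]_l (cst 1%E l))%E).
  apply: ge0_le_integral => // l _; rewrite lee_fin.
  exact: LP_fun_sqr_le1.
by rewrite integral_cst// mul1e ltry.
Qed.

Lemma disjoint_dyadic j k : j != k -> [disjoint dyadic R j & dyadic R k].
Proof. 
move=> jk; rewrite disj_set2E; apply/eqP.
by have /trivIsetP := @trivIset_dyadic R; apply.
Qed.

Let sqrtD_le (x y z : R) : 0 <= x -> 0 <= y -> 0 <= z ->
  x ^+ 2 <= y ^+ 2 + z ^+ 2 -> x <= y + z.
Proof. by move=> x0 y0 z0 h; rewrite -(@ler_pXn2r _ 2)// ?nnegrE ?addr_ge0//; nra. Qed.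

(** The square of the [k]-th function is at most the indicator of two pieces. *)
Lemma LP_le_dyadic k f : a_ k f <= hnorm (E (dyadic R k) f) + hnorm (E (dyadic R k.+1) f).
Proof.
apply: sqrtD_le; rewrite ?hnorm_ge0//.
have mD j := @measurable_dyadic R j.
have mU : measurable (dyadic R k `|` dyadic R k.+1) by exact: measurableU.
rewrite -pvm_massU//; last by apply: disjoint_dyadic; rewrite neq_ltn ltnSn.
rewrite -lee_fin hnorm_LP.
rewrite -[leRHS]mul1e -[X in (_ * X)%E]/(mu f _) -integral_cst//.
rewrite [leRHS]integral_mkcond; apply: ge0_le_integral => //.
- have := (measurable_restrictT (cst (1%E : \bar R)) mU).1 (measurable_cst _); exact.
- move=> l _; rewrite /patch; case: ifPn => [_|/negP lD].
    by rewrite lee_fin LP_fun_sqr_le1.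
  rewrite lee_fin; have [->|/(LP_fun_support g_cutoff) nz] := eqVneq (LP_fun g k l) 0.
    by rewrite expr0n.
  by exfalso; apply: lD; apply/mem_set.
Qed.

Let integral_dyadic_le j k f :
  (\int[mu f]_(l in dyadic R j) (LP_fun g k l ^+ 2)%:E <= (a_ k f ^+ 2)%:E)%E.
Proof.
rewrite hnorm_LP; apply: ge0_subset_integral => //; exact: measurable_dyadic.
Qed.

(** On a piece the two functions that live there have squares adding up to 1. *)
Lemma dyadic_le_LP k f : hnorm (E (dyadic R k.+1) f) <= a_ k f + a_ k.+1 f.
Proof.
apply: sqrtD_le; rewrite ?hnorm_ge0//.
have mD := @measurable_dyadic R k.+1.
rewrite -lee_fin -[leLHS]mul1e -[X in (_ * X)%E]/(mu f _) -integral_cst//.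
rewrite EFinD (le_trans _ (leeD (integral_dyadic_le k.+1 k f) (integral_dyadic_le k.+1 k.+1 f)))//.
rewrite -ge0_integralD//; apply: ge0_le_integral => //.
- exact: emeasurable_funD.
- by move=> l Dl; rewrite -EFinD LP_fun_sqrD.
Qed.

Lemma dyadic0_le_LP f : hnorm (E (dyadic R 0) f) <= a_ 0 f.
Proof.
have mD := @measurable_dyadic R 0.
rewrite -(@ler_pXn2r _ 2)// ?nnegrE ?hnorm_ge0//.
rewrite -lee_fin -[leLHS]mul1e -[X in (_ * X)%E]/(mu f _) -integral_cst//.
rewrite (le_trans _ (integral_dyadic_le 0 0 f))//; apply: ge0_le_integral => //.
by move=> l Dl; rewrite LP_fun_sqr0.
Qed.

End dyadic_pieces.

(** * The K-functional *)

Section K_functional.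
Context (R : realType) (H : hilbert R) (A : partial_op H).
Hypothesis A_lin : linear_op A.
Implicit Types (f : H) (t c : R).

Let splittings f t := [set k : R | exists f0 f1 : H, [/\ f = f0 + f1, dom A f1 &
    k = hnorm f0 + t * graph_norm A f1]].

Lemma graph_norm_ge0 f : 0 <= graph_norm A f.
Proof. by rewrite addr_ge0 ?hnorm_ge0. Qed.

Let splitting0 f t : splittings f t (hnorm f).
Proof.
exists f, 0; rewrite addr0 /graph_norm linear_op0// hnorm0 addr0 mulr0 addr0.
by split => //; case: A_lin.
Qed.

Lemma K_functional_ge f t c :
  (forall f0 f1, f = f0 + f1 -> dom A f1 -> c <= hnorm f0 + t * graph_norm A f1) ->
  c <= K_functional A f t.
Proof.
move=> h; apply: lb_le_inf; first by exists (hnorm f); exact: splitting0.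
by move=> k [f0 [f1 [ff df ->]]]; exact: h.
Qed.

Lemma K_functional_le f t f0 f1 : 0 <= t -> f = f0 + f1 -> dom A f1 ->
  K_functional A f t <= hnorm f0 + t * graph_norm A f1.
Proof.
move=> t0 ff df; apply: ge_inf; last by exists f0, f1.
exists 0 => k [h0 [h1 [_ _ ->]]].
by rewrite addr_ge0 ?mulr_ge0 ?hnorm_ge0 ?graph_norm_ge0.
Qed.

Lemma K_functional_ge0 f t : 0 <= t -> 0 <= K_functional A f t.
Proof.
move=> t0; apply: K_functional_ge => f0 f1 _ _.
by rewrite addr_ge0 ?mulr_ge0 ?hnorm_ge0 ?graph_norm_ge0.
Qed.

Lemma K_functional_nondecreasing f t t' : 0 <= t -> t <= t' ->
  K_functional A f t <= K_functional A f t'.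
Proof.
move=> t0 tt'; apply: K_functional_ge => f0 f1 ff df.
rewrite (le_trans (K_functional_le t0 ff df))// lerD2l ler_wpM2r//.
exact: graph_norm_ge0.
Qed.

(** The graph norm dominates the norm of the space, so that the functional is
    constant from [t = 1] on. *)
Lemma K_functional_le1 f t : 0 <= t -> K_functional A f t <= K_functional A f 1.
Proof.
move=> t0; apply: (@le_trans _ _ (hnorm f)).
  have := K_functional_le t0 (esym (addr0 f)) (proj1 A_lin).
  by rewrite /graph_norm linear_op0// hnorm0 addr0 mulr0 addr0.
apply: K_functional_ge => f0 f1 -> _; rewrite (le_trans (ler_hnormD _ _))//.
by rewrite lerD2l mul1r lerDl hnorm_ge0.
Qed.

End K_functional.

Section K_functional_dyadic.
Context (R : realType) (H : hilbert R) (E : pvm H) (S : partial_op H) (r : nat).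
Hypotheses (S_lin : linear_op S) (S_nonneg : nonnegative S).
Hypotheses (S_E : is_spectral_measure S E).
Implicit Types (f : H) (k j : nat) (t c : R).
Local Notation K := (K_functional (op_pow S r)).
Local Notation rho := (2 ^+ r : R).
Local Notation d_ f k := (hnorm (E (dyadic R k) f)).

Let rho_ge1 : 1 <= rho. Proof. by rewrite exprn_ege1// ler1n. Qed.

(** In any splitting of [f], the piece of the rough part is bounded by its norm,
    and that of the smooth part [f1], for [k > 0], by [2 ^- ((k - 1) r)] times the
    norm of [S ^ r f1], because the spectrum in question lies above [2 ^ (k - 1)].
    For [k = 0] the norm of [f1], a part of its graph norm, suffices. *)
Lemma dyadic_le_K f k t c : 0 <= t -> 1 <= c -> rho <= c * t * rho ^+ k ->
  d_ f k <= c * K f t.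
Proof.
move=> t0 c1 ct; have c0 : 0 < c by rewrite (lt_le_trans _ c1).
have mD := @measurable_dyadic R k.
rewrite mulrC -ler_pdivrMr//; apply: K_functional_ge; first exact: op_pow_linear.
move=> f0 f1 -> df; rewrite ler_pdivrMr// linearD/=.
rewrite (le_trans (ler_hnormD _ _))// mulrDl lerD//.
  by rewrite (le_trans (pvm_contract E f0 mD))// ler_peMr ?hnorm_ge0.
rewrite mulrAC [t * c]mulrC.
have ct0 : 0 <= c * t by rewrite mulr_ge0// ltW.
case: k ct mD => [|k] ct mD.
  rewrite (le_trans (pvm_contract E f1 mD))//.
  have ct1 : 1 <= c * t by rewrite (le_trans rho_ge1)// -[leRHS]mulr1 -(expr0 rho).
  rewrite (@le_trans _ _ (graph_norm (op_pow S r) f1))// ?ler_peMl ?graph_norm_ge0//.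
  by rewrite lerDl hnorm_ge0.
have low l : dyadic R k.+1 l -> 2 ^+ k <= l.
  by rewrite /dyadic/= in_itv/= => /andP[/ltW].
have k0 : (0 : R) <= 2 ^+ k by rewrite exprn_ge0.
have h := op_pow_ge S_E df mD k0 low.
have h1 : 1 <= c * t * (2 ^+ k) ^+ r.
  move: ct; rewrite exprS mulrCA -[leLHS]mulr1 ler_pM2l ?exprn_gt0//.
  by rewrite -!exprM mulnC.
apply: (@le_trans _ _ (c * t * (2 ^+ k) ^+ r * hnorm (E (dyadic R k.+1) f1))).
  by rewrite ler_peMl ?hnorm_ge0.
rewrite -mulrA ler_wpM2l// (le_trans h)// (le_trans (pvm_contract E _ mD))//.
by rewrite lerDr hnorm_ge0.
Qed.

Definition dyadic_tail f j : R := hnorm (f - \sum_(0 <= k < j.+1) E (dyadic R k) f).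

Lemma dyadic_tail_ge0 f j : 0 <= dyadic_tail f j.
Proof. exact: hnorm_ge0. Qed.

(** The competitor truncates the spectrum at [2 ^ j]. On the piece [k] the
    operator [S ^ r] costs at most [rho ^ k]; the factor 2 absorbs the norm of
    the vector itself, which is part of the graph norm. *)
Lemma K_le_dyadic f j : K f (rho ^- j) <=
  dyadic_tail f j + 2 * \sum_(0 <= k < j.+1) rho ^+ k / rho ^+ j * d_ f k.
Proof.
have r0 : 0 <= rho ^- j by rewrite invr_ge0 exprn_ge0// exprn_ge0.
have piece k : dom (op_pow S r) (E (dyadic R k) f) /\
    hnorm (op_pow S r (E (dyadic R k) f)) <= (2 ^+ k) ^+ r * d_ f k.
  have mD := @measurable_dyadic R k.
  have k0 : (0 : R) <= 2 ^+ k by rewrite exprn_ge0.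
  apply: (op_pow_bounded S_E r mD k0); first by rewrite pvm_idem.
  by move=> l dl; rewrite ger0_norm ?(dyadic_ge0 dl)// dyadic_le.
have [df Sf] := op_pow_sum S_lin (index_iota 0 j.+1) (fun k => proj1 (piece k)).
set f1 := \sum_(0 <= k < j.+1) _ in df Sf.
rewrite (le_trans (K_functional_le r0 (esym (subrK f1 f)) df))// lerD2l.
have : graph_norm (op_pow S r) f1 <= 2 * \sum_(0 <= k < j.+1) rho ^+ k * d_ f k.
  rewrite mulr_sumr /graph_norm Sf (le_trans (lerD (hnorm_sum _ _ _) (hnorm_sum _ _ _)))//.
  rewrite -big_split/=; apply: ler_sum => k _.
  have [_ h] := piece k; rewrite mulrA mulrDl mul1r mulrDl lerD//.
    by rewrite ler_peMl ?hnorm_ge0// exprn_ege1.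
  by rewrite (le_trans h)// -!exprM mulnC.
move=> /(ler_wpM2l r0) h; rewrite (le_trans h)// mulrCA ler_wpM2l// mulr_sumr.
by apply: ler_sum => k _; rewrite mulrA [rho ^- j * _]mulrC.
Qed.

Lemma bigcup_dyadic : \bigcup_k dyadic R k = `[0, +oo[%classic.
Proof.
apply/seteqP; split=> [l [k _ /dyadic_ge0]|l].
  by rewrite /= in_itv/= andbT.
rewrite /= in_itv/= andbT => l0.
have [k] : exists k, l <= 2 ^+ k.
  have lb := archi_boundP l0; exists (Num.bound l); rewrite (le_trans (ltW lb))//.
  by rewrite -natrX ler_nat ltnW// ltn_expl.
elim: k => [|k IH] lk; first by exists 0%N => //=; rewrite /dyadic/= in_itv/= l0 -(expr0 2).
have [/IH//|kl] := leP l (2 ^+ k).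
by exists k.+1 => //=; rewrite /dyadic/= in_itv/= kl.
Qed.

(** The pieces exhaust the vector because the spectrum is nonnegative. *)
Lemma dyadic_tail_cvg0 f : dyadic_tail f @ \oo --> (0 : R).
Proof.
have mD := @measurable_dyadic R.
have Ef : E `[0, +oo[%classic f = f.
  have mI : measurable (`[0, +oo[%classic : set R) by exact: measurable_itv.
  rewrite -[RHS](pvm_setT E) -(setUv `[0%R, +oo[%classic) pvmU//; last 2 first.
  - exact: measurableC.
  - by rewrite disj_set2E setICr.
  rewrite (_ : ~` _ = `]-oo, 0[%classic) ?(pvm_negative S_nonneg S_E) ?addr0//.
  by rewrite setCitvr.
have := @pvm_sigma_additive _ _ E _ f mD (@trivIset_dyadic R).
rewrite bigcup_dyadic Ef => /cvg_hnormB h.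
rewrite -(cvg_shiftS (fun n => hnorm (\sum_(0 <= i < n) E (dyadic R i) f - f))) in h.
rewrite (_ : dyadic_tail f = (fun n =>
  hnorm (\sum_(0 <= i < n.+1) E (dyadic R i) f - f)))//.
by apply/funext => n; rewrite /dyadic_tail hnormBC.
Qed.

Lemma dyadic_tail_le f j n : (j <= n)%N ->
  dyadic_tail f j <= \sum_(j <= k < n) d_ f k.+1 + dyadic_tail f n.
Proof.
move=> jn; rewrite /dyadic_tail (@big_cat_nat _ _ _ j.+1 0 n.+1)//=.
rewrite opprD addrA; set x := f - _; rewrite big_add1/=.
set y := \sum_(j <= k < n) E _ f.
have -> : hnorm x = hnorm (y + (x - y)) by rewrite addrC subrK.
by rewrite (le_trans (ler_hnormD _ _))// lerD2r hnorm_sum.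
Qed.

(** A remainder far enough is at most half of a nonzero tail, which turns the
    tail into a finite sum at the price of a factor 2. *)
Lemma dyadic_tail_finite f j : \forall n \near \oo,
  dyadic_tail f j <= 2 * \sum_(j <= k < n) d_ f k.+1.
Proof.
have [->|T0] := eqVneq (dyadic_tail f j) 0.
  by near=> n; rewrite mulr_ge0// sumr_ge0// => k _; rewrite hnorm_ge0.
have {}T0 : 0 < dyadic_tail f j / 2.
  by rewrite divr_gt0// lt_neqAle eq_sym T0 dyadic_tail_ge0.
near=> n.
have jn : (j <= n)%N by near: n; exists j.
have tn : dyadic_tail f n < dyadic_tail f j / 2.
  by near: n; apply: (cvgr_lt 0 (dyadic_tail_cvg0 f)).
by have := dyadic_tail_le f jn; lra.
Unshelve. all: by end_near. Qed.

End K_functional_dyadic.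

(** * Discrete Hardy inequalities *)

Section lq_bound.
Context (R : realType).
Implicit Types (q : \bar R) (p X Y rho lam : R) (b c u w : nat -> R).

(** For nonnegative sequences this is the bound [lq_norm q c <= X]; in this form
    the estimates below are about finite sums of real numbers. *)
Definition lq_le q c X : Prop :=
  match q with
  | p%:E => forall n, \sum_(0 <= i < n) c i `^ p <= X `^ p
  | +oo%E => forall n, c n <= X
  | -oo%E => True
  end.

Lemma ler_poweR2 (x y : \bar R) (a : R) :
  0 <= a -> (0 <= x)%E -> (x <= y)%E -> (poweR x a <= poweR y a)%E.
Proof.
move=> a0 x0 xy; apply: gt0_ler_poweR => //; rewrite in_itv/= ?leey ?andbT//.
exact: le_trans xy.
Qed.

Lemma lq_norm_le q c X : (1 <= q)%E -> (forall i, 0 <= c i) -> 0 <= X ->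
  (lq_norm q c <= X%:E)%E <-> lq_le q c X.
Proof.
move=> q1 c0 X0; case: q q1 => [p p1| _ |//] /=; last first.
  split=> [h n|h].
    rewrite -lee_fin; apply: le_trans h; apply: ereal_sup_ubound; exists n => //.
    by rewrite ger0_norm.
  by apply: ub_ereal_sup => _ [n _ <-]; rewrite lee_fin ger0_norm.
rewrite lee_fin in p1; have p0 : 0 < p by lra.
rewrite (eq_eseriesr (g := fun j => (c j `^ p)%:E)); last first.
  by move=> j _; rewrite ger0_norm.
set s := (\sum_(0 <= j <oo) _)%E.
have s0 : (0 <= s)%E by apply: nneseries_ge0 => j _ _; rewrite lee_fin powR_ge0.
have sX : (poweR s p^-1 <= X%:E)%E <-> (s <= (X `^ p)%:E)%E.
  have -> : (X `^ p)%:E = poweR X%:E p by [].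
  split=> h.
    have -> : s = poweR (poweR s p^-1) p.
      by rewrite -poweRrM mulVf ?gt_eqF// poweRe1.
    by apply: ler_poweR2 => //; [exact: ltW|exact: poweR_ge0].
  have -> : X%:E = poweR (poweR X%:E p) p^-1.
    by rewrite -poweRrM mulfV ?gt_eqF// poweRe1.
  by apply: ler_poweR2 => //; rewrite invr_ge0 ltW.
rewrite sX; split=> [h n|h].
  rewrite -lee_fin -sumEFin; apply: le_trans h.
  by apply: nneseries_lim_ge => j _; rewrite lee_fin powR_ge0.
apply: lime_le; first by apply: is_cvg_nneseries => j _ _; rewrite lee_fin powR_ge0.
by near=> n; rewrite sumEFin lee_fin.
Unshelve. all: by end_near. Qed.

Lemma lq_le_mono q c u X Y : (1 <= q)%E -> (forall i, 0 <= u i) -> 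
  (forall i, u i <= c i) -> 0 <= X -> X <= Y -> lq_le q c X -> lq_le q u Y.
Proof.
move=> q1 u0 uc X0 XY; case: q q1 => [p p1 h n| _ h n|//] /=; last first.
  by rewrite (le_trans (uc n))// (le_trans _ XY).
rewrite lee_fin in p1; have p0 : 0 <= p by lra.
apply: (@le_trans _ _ (X `^ p)); last by rewrite ge0_ler_powR ?nnegrE// (le_trans X0).
apply: le_trans (h n); apply: ler_sum => i _.
by rewrite ge0_ler_powR ?nnegrE ?u0// (le_trans (u0 i)).
Qed.

Lemma lq_leZ q lam c X : (1 <= q)%E -> 0 <= lam -> (forall i, 0 <= c i) -> 0 <= X ->
  lq_le q c X -> lq_le q (fun i => lam * c i) (lam * X).
Proof.
move=> q1 l0 c0 X0; case: q q1 => [p p1 h n| _ h n|//] /=; last first.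
  by rewrite ler_wpM2l.
rewrite powRM// (le_trans _ (ler_wpM2l (powR_ge0 _ _) (h n)))// mulr_sumr.
by apply: ler_sum => i _; rewrite powRM.
Qed.

(** The constant comes from [(x + y)^p <= 2^p (x^p + y^p)] and [2 <= 2^p]. *)
Lemma lq_leD q c u X Y : (1 <= q)%E -> (forall i, 0 <= c i) -> (forall i, 0 <= u i) ->
  0 <= X -> 0 <= Y -> lq_le q c X -> lq_le q u Y ->
  lq_le q (fun i => c i + u i) (4 * (X + Y)).
Proof.
move=> q1 c0 u0 X0 Y0; case: q q1 => [p p1 hX hY n| _ hX hY n|//] /=; last first.
  have := hX n; have := hY n; lra.
rewrite lee_fin in p1; have p0 : 0 <= p by lra.
have mono x y : 0 <= x -> x <= y -> x `^ p <= y `^ p.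
  by move=> x0 xy; rewrite ge0_ler_powR ?nnegrE// (le_trans x0).
have two : 2 <= 2 `^ p :> R by rewrite -[leLHS]powRr1// ler_powR// ler1n.
have add x y : 0 <= x -> 0 <= y -> (x + y) `^ p <= 2 `^ p * (x `^ p + y `^ p).
  move=> x0 y0; have [xy|yx] := leP x y.
    rewrite (@le_trans _ _ ((2 * y) `^ p))//; first by apply: mono; lra.
    by rewrite powRM// ler_wpM2l ?powR_ge0// lerDr powR_ge0.
  rewrite (@le_trans _ _ ((2 * x) `^ p))//; first by apply: mono; lra.
  by rewrite powRM// ler_wpM2l ?powR_ge0// lerDl powR_ge0.
apply: (@le_trans _ _ (2 `^ p * (X `^ p + Y `^ p))).
  rewrite (le_trans (ler_sum _ (fun i _ => add _ _ (c0 i) (u0 i))))//.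
  by rewrite -mulr_sumr ler_wpM2l ?powR_ge0// big_split lerD.
rewrite (_ : 4 = 2 * 2 :> R); last by ring.
rewrite -mulrA powRM// ?mulr_ge0 ?addr_ge0// ler_wpM2l ?powR_ge0//.
rewrite powRM// ?addr_ge0//.
have hx : X `^ p <= (X + Y) `^ p by apply: mono => //; lra.
have hy : Y `^ p <= (X + Y) `^ p by apply: mono => //; lra.
by have := ler_wpM2r (powR_ge0 (X + Y) p) two; lra.
Qed.

Lemma lq_le_shift q c X : (1 <= q)%E -> lq_le q c X -> lq_le q (fun i => c i.+1) X.
Proof.
case: q => [p _ h n| _ h n|//] /=; last exact: h.
rewrite (le_trans _ (h n.+1))// [leRHS]big_nat_recl//= lerDr powR_ge0//.
Qed.

Lemma lq_le_cons q c X : (1 <= q)%E -> 0 <= X -> lq_le q c X ->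
  lq_le q (fun i => if i is j.+1 then c j else 0) X.
Proof.
move=> + X0; case: q => [p p1 h [|n]| _ h [|n]|//] //=.
  by rewrite big_nil powR_ge0.
rewrite lee_fin in p1; rewrite big_nat_recl//= powR0 ?add0r//.
by rewrite gt_eqF//; lra.
Qed.

(** Lets the index at which a tail is cut off grow with the number of terms. *)
Lemma lq_le_local q c X : (1 <= q)%E -> (forall i, 0 <= c i) ->
  (forall n, exists2 u, (forall i, (i < n)%N -> c i <= u i) & lq_le q u X) ->
  lq_le q c X.
Proof.
move=> q1 c0 loc; case: q q1 loc => [p p1|_|//] loc n /=; last first.
  by have [u cu /(_ n)] := loc n.+1; apply: le_trans; exact: cu.
rewrite lee_fin in p1.
have [u cu /(_ n)] := loc n; apply: le_trans; rewrite big_nat [leRHS]big_nat.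
apply: ler_sum => i /andP[_ /cu ci].
by have ui := le_trans (c0 i) ci; rewrite ge0_ler_powR ?nnegrE//; lra.
Qed.

(** Convexity of the power function, with weights [1 - rho] at [x / (1 - rho)]
    and [rho] at [y]. *)
Lemma powR_convex_step p rho (x y : R) : 1 <= p -> 0 < rho -> rho < 1 ->
  0 <= x -> 0 <= y ->
  (x + rho * y) `^ p <=
  (1 - rho) * (1 - rho)^-1 `^ p * x `^ p + rho * y `^ p.
Proof.
move=> p1 rho0 rho1 x0 y0; have r1 : 0 < 1 - rho by lra.
have r0' : 0 <= 1 - rho by lra.
have r1' : 1 - rho <= 1 by lra.
have z0 : 0 <= (1 - rho)^-1 * x by rewrite mulr_ge0// invr_ge0.
have mem z : 0 <= z -> z \in (`[0, +oo[%classic : set R).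
  by move=> ?; apply/mem_set; rewrite /= in_itv/= andbT.
have : ((1 - rho) * ((1 - rho)^-1 * x) + (1 - (1 - rho)) * y) `^ p <=
    (1 - rho) * ((1 - rho)^-1 * x) `^ p + (1 - (1 - rho)) * y `^ p.
  exact: (convex_powR p1 (Itv01 r0' r1') (mem _ z0) (mem _ y0)).
rewrite opprB addrCA subrr addr0.
by rewrite mulVKf ?gt_eqF// powRM ?invr_ge0// mulrA.
Qed.

(** Summing the convexity step over [i] reproduces [rho] times the left-hand
    side, which is absorbed as [rho < 1]. This is the discrete Hardy inequality
    for the kernel [rho ^ (j - i)]. *)
Lemma powR_sum_recursion p rho w c (kappa := (1 - rho) * (1 - rho)^-1 `^ p) :
  1 <= p -> 0 < rho -> rho < 1 -> (forall i, 0 <= w i) -> (forall i, 0 <= c i) ->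
  w 0%N <= c 0%N -> (forall i, w i.+1 <= c i.+1 + rho * w i) -> forall n,
  \sum_(0 <= i < n) w i `^ p <= kappa / (1 - rho) * \sum_(0 <= i < n) c i `^ p.
Proof.
move=> p1 rho0 rho1 w0 c0 wc0 wS; have powR_step x y : 0 <= x -> 0 <= y ->
    (x + rho * y) `^ p <= kappa * x `^ p + rho * y `^ p.
  exact: powR_convex_step.
move: kappa powR_step => kappa powR_step.
have p0 : 0 <= p by lra.
have mono x y : 0 <= x -> x <= y -> x `^ p <= y `^ p.
  by move=> x0 xy; rewrite ge0_ler_powR ?nnegrE// (le_trans x0).
have step n : \sum_(0 <= i < n.+1) w i `^ p <=
    kappa * \sum_(0 <= i < n.+1) c i `^ p + rho * \sum_(0 <= i < n) w i `^ p.
  elim: n => [|n IH].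
    rewrite !big_nat1 big_nil mulr0 addr0.
    have := powR_step _ _ (c0 0%N) (lexx 0).
    by rewrite mulr0 addr0 powR0 ?gt_eqF ?mulr0 ?addr0//; [exact/le_trans/mono|lra].
  rewrite big_nat_recr//= [in leRHS]big_nat_recr//= [X in _ + rho * X]big_nat_recr//=.
  have := le_trans (mono _ _ (w0 n.+1) (wS n)) (powR_step _ _ (c0 n.+1) (w0 n)).
  by move: IH; lra.
move=> n; rewrite mulrAC ler_pdivlMr; last by lra.
have : \sum_(0 <= i < n) w i `^ p <= kappa * \sum_(0 <= i < n) c i `^ p +
    rho * \sum_(0 <= i < n) w i `^ p.
  case: n => [|n]; first by rewrite !big_nil !mulr0 addr0.
  rewrite (le_trans (step n))// lerD2l ler_pM2l// big_nat_recr//= lerDl.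
  exact: powR_ge0.
lra.
Qed.

Lemma lq_le_recursion q rho : (1 <= q)%E -> 0 < rho -> rho < 1 ->
  exists2 A : R, 0 < A & forall w c X, 0 <= X ->
  (forall i, 0 <= w i) -> (forall i, 0 <= c i) ->
  w 0%N <= c 0%N -> (forall i, w i.+1 <= c i.+1 + rho * w i) ->
  lq_le q c X -> lq_le q w (A * X).
Proof.
move=> q1 r0 r1; case: q q1 => [p p1|_|//]; last first.
  exists (1 - rho)^-1; first by rewrite invr_gt0; lra.
  move=> w c X X0 w0 c0 wc0 wS cX n /=; rewrite mulrC ler_pdivlMr; last by lra.
  elim: n => [|n IH]; first by have := cX 0%N; have := w0 0%N; nra.
  have := cX n.+1; have := wS n; nra.
rewrite lee_fin in p1; have p0 : 0 < p by lra.
pose k := (1 - rho) * (1 - rho)^-1 `^ p / (1 - rho).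
have k0 : 0 < k.
  by rewrite divr_gt0 ?mulr_gt0 ?powR_gt0 ?invr_gt0//; lra.
exists (k `^ p^-1); first exact: powR_gt0.
move=> w c X X0 w0 c0 wc0 wS cX n /=.
rewrite (le_trans (powR_sum_recursion p1 r0 r1 w0 c0 wc0 wS n))// -/k.
rewrite powRM ?powR_ge0// -powRrM mulVf ?gt_eqF// powRr1 ?(ltW k0)//.
by rewrite ler_wpM2l ?(ltW k0).
Qed.

Definition seq_rev (m : nat) u (i : nat) : R :=
  if (i < m)%N then u (m - i.+1)%N else 0.

Lemma lq_le_seq_rev q m c X : (1 <= q)%E -> 0 <= X ->
  lq_le q c X -> lq_le q (seq_rev m c) X.
Proof.
move=> q1 X0; case: q q1 => [p p1|_|//] /= cX n; last first.
  by rewrite /seq_rev; case: ifP.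
rewrite lee_fin in p1; have p0 : p != 0 by rewrite gt_eqF//; lra.
have sum_rev : \sum_(0 <= i < m) seq_rev m c i `^ p = \sum_(0 <= i < m) c i `^ p.
  rewrite [RHS]big_nat_rev/= !big_nat; apply: eq_bigr => i /andP[_ im].
  by rewrite /seq_rev im add0n.
apply: le_trans (cX m); rewrite -sum_rev.
have [nm|mn] := leqP n m.
  by rewrite [leRHS](@big_cat_nat _ _ _ n)//= lerDl sumr_ge0// => i _; exact: powR_ge0.
rewrite (@big_cat_nat _ _ _ m)//= ?(ltnW mn)// [X in _ + X]big_nat.
rewrite [X in _ + X]big1 ?addr0// => i /andP[mi _].
by rewrite /seq_rev ltnNge mi/= powR0.
Qed.

(** A backward recursion that ends with zeros becomes a forward one when the
    sequence is read from its end. *)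
Lemma lq_le_backward_recursion q rho : (1 <= q)%E -> 0 < rho -> rho < 1 ->
  exists2 A : R, 0 < A & forall w c X m, 0 <= X ->
  (forall i, 0 <= w i) -> (forall i, 0 <= c i) ->
  (forall i, (m <= i)%N -> w i = 0) -> (forall i, w i <= c i + rho * w i.+1) ->
  lq_le q c X -> lq_le q w (A * X).
Proof.
move=> q1 r0 r1; have [A A0 hA] := lq_le_recursion q1 r0 r1.
exists A => // w c X m X0 w0 c0 wm wS cX.
have rv0 u : (forall i, 0 <= u i) -> forall i, 0 <= seq_rev m u i.
  by move=> u0 i; rewrite /seq_rev; case: ifP.
have -> : w = seq_rev m (seq_rev m w).
  apply/funext => i; rewrite /seq_rev; case: ltnP => [im|/wm//].
  by rewrite ltn_subrL /= (leq_trans _ im)//= subnSK// subKn// ltnW.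
apply: lq_le_seq_rev => //; first by rewrite mulr_ge0// ltW.
apply: (hA _ (seq_rev m c)) => //; [exact: rv0|exact: rv0| | |exact: lq_le_seq_rev].
- rewrite /seq_rev; case: ltnP => // m0; have := wS (m - 1)%N.
  by rewrite subn1 prednK// (wm m)// mulr0 addr0.
- move=> i; rewrite /seq_rev; case: (ltnP i.+1 m) => im; last first.
    by rewrite add0r mulr_ge0 ?(ltW r0)//; case: ifP.
  by rewrite (ltn_trans _ im)//; have := wS (m - i.+2)%N; rewrite subnSK.
Qed.

End lq_bound.

(** * From dyadic pieces to the K-functional in sequence norms *)

Section discrete_hardy.
Context (R : realType) (H : hilbert R) (E : pvm H) (S : partial_op H) (r : nat).
Context (g : R -> R) (q : \bar R) (lam : R).
Hypotheses (S_lin : linear_op S) (S_nonneg : nonnegative S).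
Hypotheses (S_E : is_spectral_measure S E) (g_cutoff : cutoff g).
Hypotheses (q1 : (1 <= q)%E) (lam_gt1 : 1 < lam) (lam_lt : lam < 2 ^+ r).
Implicit Types (f : H) (k j : nat).
Local Notation K := (K_functional (op_pow S r)).
Local Notation rho := (2 ^+ r : R).
Local Notation d_ f k := (hnorm (E (dyadic R k) f)).
Local Notation a_ f k := (hnorm (spectral_op E (LP_fun g k) f)).

Let lam0 : 0 < lam. Proof. exact: lt_trans lam_gt1. Qed.

Lemma lq_le_dyadic f X : 0 <= X -> lq_le q (fun j => lam ^+ j * a_ f j) X ->
  lq_le q (fun j => lam ^+ j * d_ f j) (4 * (X + lam * X)).
Proof.
move=> X0 aX; set b := fun j => _ in aX.
have b0 j : 0 <= b j by rewrite mulr_ge0 ?hnorm_ge0 ?exprn_ge0 ?(ltW lam0).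
pose b' j := if j is i.+1 then b i else 0.
have b'0 j : 0 <= b' j by case: j => /=.
have l0 := ltW lam0.
have lX : 0 <= lam * X by rewrite mulr_ge0.
have b'X := lq_leZ q1 l0 b'0 X0 (lq_le_cons q1 X0 aX).
have lb'0 j : 0 <= lam * b' j by rewrite mulr_ge0.
apply: lq_le_mono (lq_leD q1 b0 lb'0 X0 lX aX b'X) => //.
- by move=> j; rewrite mulr_ge0 ?hnorm_ge0 ?exprn_ge0.
- case=> [|j]; first by rewrite mulr0 addr0 ler_wpM2l ?exprn_ge0// dyadic0_le_LP.
  rewrite /= /b mulrA -exprS -mulrDr ler_wpM2l ?exprn_ge0// addrC.
  exact: dyadic_le_LP.
- by rewrite mulr_ge0// addr_ge0.
Qed.

Let near_all (P : nat -> nat -> Prop) n :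
  (forall j, \forall m \near \oo, P j m) ->
  \forall m \near \oo, forall j, (j < n)%N -> P j m.
Proof.
move=> h; elim: n => [|n IH]; first by near=> m.
near=> m => j; rewrite ltnS leq_eqVlt => /orP[/eqP ->|]; first by near: m.
by move: j; near: m.
Unshelve. all: by end_near. Qed.

(** Truncating at [2 ^ j] leaves a low part and a tail. Weighted by [lam ^ j], the
    low part satisfies a forward recursion with ratio [lam / rho] and the tail a
    backward one with ratio [lam^-1]; both ratios are smaller than 1. *)
Lemma lq_le_K_dyadic : exists2 A : R, 0 < A & forall f X, 0 <= X ->
  lq_le q (fun j => lam ^+ j * d_ f j) X ->
  lq_le q (fun j => lam ^+ j * K f (rho ^- j)) (A * X).
Proof.
have l0 := ltW lam0.
have rho0 : 0 < rho by rewrite (lt_trans lam0).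
have [|||A1 A10 fwd] := @lq_le_recursion R q (lam / rho) => //.
- by rewrite divr_gt0.
- by rewrite ltr_pdivrMr// mul1r.
have [|||A2 A20 bwd] := @lq_le_backward_recursion R q lam^-1 => //.
- by rewrite invr_gt0.
- by rewrite invf_lt1.
exists (4 * (2 * A2 + 2 * A1)); first by rewrite mulr_gt0// addr_gt0// mulr_gt0.
move=> f X X0 dX.
have b0 j : 0 <= lam ^+ j * d_ f j by rewrite mulr_ge0 ?exprn_ge0 ?hnorm_ge0.
pose w j := lam ^+ j * \sum_(0 <= k < j.+1) rho ^+ k / rho ^+ j * d_ f k.
have w0 j : 0 <= w j.
  rewrite mulr_ge0 ?exprn_ge0// sumr_ge0// => k _.
  by rewrite !mulr_ge0 ?invr_ge0 ?hnorm_ge0// exprn_ge0// ltW.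
have wX : lq_le q w (A1 * X).
  apply: fwd dX => // [|j].
    by rewrite /w big_nat1 !expr0 divff ?oner_eq0// !mul1r.
  have -> : w j.+1 = lam ^+ j.+1 * d_ f j.+1 +
      lam ^+ j.+1 * (rho^-1 * \sum_(0 <= k < j.+1) rho ^+ k / rho ^+ j * d_ f k).
    rewrite /w big_nat_recr//= divff ?expf_neq0 ?gt_eqF// mul1r addrC mulrDr.
    congr (_ + _ * _); rewrite mulr_sumr; apply: eq_bigr => k _.
    by rewrite [rho ^+ j.+1]exprS invfM; ring.
  by rewrite /w lerD2l exprS le_eqVlt; apply/orP; left; apply/eqP; ring.
pose v n j := lam ^+ j * \sum_(j <= k < n) d_ f k.+1.
have v0 n j : 0 <= v n j.
  by rewrite mulr_ge0 ?exprn_ge0// sumr_ge0// => k _; exact: hnorm_ge0.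
have vX n : lq_le q (v n) (A2 * X).
  apply: (bwd _ _ _ n X0 (v0 n) (fun j => b0 j.+1) _ _ (lq_le_shift q1 dX)).
    by move=> j nj; rewrite /v big_geq// mulr0.
  move=> j; rewrite /v; have [jn|nj] := ltnP j n; last first.
    by rewrite big_geq// mulr0 addr_ge0// mulr_ge0 ?invr_ge0//; exact: v0.
  rewrite big_ltn// mulrDr exprS -!mulrA mulKf ?gt_eqF// lerD2r.
  by rewrite ler_peMl ?(ltW lam_gt1)// mulr_ge0 ?exprn_ge0 ?hnorm_ge0.
apply: lq_le_local => // [j|n].
  rewrite mulr_ge0 ?exprn_ge0// K_functional_ge0 ?invr_ge0 ?exprn_ge0 ?(ltW rho0)//.
  exact: op_pow_linear.
have tails := near_all n (dyadic_tail_finite S_nonneg S_E f).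
near \oo => m.
exists (fun j => 2 * v m j + 2 * w j).
  move=> j jn; have tj : dyadic_tail E f j <= 2 * \sum_(j <= k < m) d_ f k.+1.
    by move: j jn; near: m.
  have := ler_wpM2l (exprn_ge0 j l0) (K_le_dyadic r S_lin S_E f j).
  have := ler_wpM2l (exprn_ge0 j l0) tj.
  rewrite /v /w; lra.
have A1X : 0 <= A1 * X by rewrite mulr_ge0 ?(ltW A10).
have A2X : 0 <= A2 * X by rewrite mulr_ge0 ?(ltW A20).
have two : 0 <= 2 :> R by [].
rewrite (_ : _ * X = 4 * (2 * (A2 * X) + 2 * (A1 * X))); last by ring.
apply: lq_leD => //; try by move=> i; rewrite mulr_ge0.
- by rewrite mulr_ge0.
- by rewrite mulr_ge0.
- exact: lq_leZ.
- exact: lq_leZ.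
Unshelve. all: by end_near. Qed.

End discrete_hardy.

(** * Integrals over geometric intervals *)

Section dyadic_integral.
Context (R : realType).
Local Notation leb := (@lebesgue_measure R).
Implicit Types (h : R -> R) (F : nat -> set R) (v : nat -> R).

Lemma trivIset_nondecreasing_itv v : (forall i j, (i <= j)%N -> v i <= v j) ->
  trivIset setT (fun j => `]v j, v j.+1]%classic).
Proof.
move=> vi; have lt i j x : (i < j)%N -> v i < x <= v i.+1 -> v j < x <= v j.+1 -> False.
  move=> /vi ij /andP[_ xi] /andP[jx _].
  by have := lt_le_trans jx (le_trans xi ij); rewrite ltxx.
move=> i j _ _ [x [/=]]; rewrite !in_itv/= => xi xj.
by case: (ltngtP i j) => // ij; [case: (lt _ _ _ ij xi xj)|case: (lt _ _ _ ij xj xi)].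
Qed.

Lemma trivIset_nonincreasing_itv v : (forall i j, (i <= j)%N -> v j <= v i) ->
  trivIset setT (fun j => `]v j.+1, v j]%classic).
Proof.
move=> vi; have lt i j x : (i < j)%N -> v i.+1 < x <= v i -> v j.+1 < x <= v j -> False.
  move=> /vi ij /andP[ix _] /andP[_ xj].
  by have := lt_le_trans ix (le_trans xj ij); rewrite ltxx.
move=> i j _ _ [x [/=]]; rewrite !in_itv/= => xi xj.
by case: (ltngtP i j) => // ij; [case: (lt _ _ _ ij xi xj)|case: (lt _ _ _ ij xj xi)].
Qed.

Lemma geometric_unbounded (rho x : R) : 2 <= rho -> 0 <= x ->
  exists j : nat, x < rho ^+ j.
Proof.
move=> rho2 x0; exists (Num.bound x); rewrite (lt_le_trans (archi_boundP x0))//.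
rewrite (@le_trans _ _ (2 ^+ Num.bound x))//; last by rewrite lerXn2r ?nnegrE//; lra.
by rewrite -natrX ler_nat ltnW// ltn_expl.
Qed.

Lemma bigcup_geometric_itv (rho : R) : 2 <= rho ->
  \bigcup_j `]rho ^+ j, rho ^+ j.+1]%classic = `]1, +oo[%classic.
Proof.
move=> rho2; apply/seteqP; split=> x.
  move=> [j _ /=]; rewrite !in_itv/= andbT => /andP[jx _].
  by rewrite (le_lt_trans _ jx)// exprn_ege1//; lra.
rewrite /= in_itv/= andbT => x1.
have [j /ltW] := geometric_unbounded rho2 (le_trans ler01 (ltW x1)).
elim: j => [|j IH] xj; first by rewrite expr0 leNgt x1 in xj.
have [/IH//|jx] := leP x (rho ^+ j).
by exists j => //=; rewrite in_itv/= jx.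
Qed.

Lemma bigcup_geometric_itvV (rho : R) : 2 <= rho ->
  \bigcup_j `]rho ^- j.+1, rho ^- j]%classic = `]0, 1]%classic.
Proof.
move=> rho2; have rho0 : 0 < rho by lra.
have pos j : 0 < rho ^+ j by rewrite exprn_gt0.
apply/seteqP; split=> x.
  move=> [j _ /=]; rewrite !in_itv/= => /andP[jx xj].
  rewrite (lt_trans _ jx) ?invr_gt0//= (le_trans xj)// invf_le1//.
  by rewrite exprn_ege1//; lra.
rewrite /= in_itv/= => /andP[x0 x1].
have xV0 : 0 <= x^-1 by rewrite invr_ge0 ltW.
have [j] := geometric_unbounded rho2 xV0.
elim: j => [|j IH] xj; first by rewrite expr0 ltNge invf_ge1// x1 in xj.
have [/IH//|jx] := ltP x^-1 (rho ^+ j).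
exists j => //=; rewrite in_itv/=; apply/andP; split.
  by rewrite invf_plt ?posrE.
by rewrite invf_pge ?posrE.
Qed.

Let integral_cst_itv (a b c : R) : a <= b ->
  (\int[leb]_(t in `]a, b]) c%:E = (c * (b - a))%:E)%E.
Proof.
move=> ab; rewrite integral_cst; last exact: measurable_itv.
rewrite -[X in (_ * X)%E]/(leb `]a, b]%classic) lebesgue_measure_itv/= lte_fin.
case: ltP => ba; first by rewrite -EFinB -EFinM.
have -> : b = a by apply/eqP; rewrite eq_le ab ba.
by rewrite subrr mulr0 mule0.
Qed.

Lemma integral_itv_le h (a b c : R) : a <= b ->
  measurable_fun `]a, b] h ->
  (forall t, a < t <= b -> 0 <= h t <= c) ->
  (\int[leb]_(t in `]a, b]) (h t)%:E <= (c * (b - a))%:E)%E.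
Proof.
move=> ab mh hc.
have mI : measurable (`]a, b]%classic : set R) by exact: measurable_itv.
apply: (@le_trans _ _ (\int[leb]_(t in `]a, b]) c%:E)%E).
  apply: ge0_le_integral => //.
  - by move=> t /=; rewrite in_itv/= lee_fin => /hc/andP[].
  - exact/measurable_EFinP.
  - by move=> t /=; rewrite in_itv/= lee_fin => /hc/andP[].
by rewrite integral_cst_itv ?lexx.
Qed.

Lemma integral_itv_ge h (a b c : R) : a <= b -> 0 <= c ->
  measurable_fun `]a, b] h ->
  (forall t, a < t <= b -> c <= h t) ->
  ((c * (b - a))%:E <= \int[leb]_(t in `]a, b]) (h t)%:E)%E.
Proof.
move=> ab c0 mh hc.
have mI : measurable (`]a, b]%classic : set R) by exact: measurable_itv.
apply: (@le_trans _ _ (\int[leb]_(t in `]a, b]) c%:E)%E).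
  by rewrite integral_cst_itv ?lexx.
apply: ge0_le_integral => //.
exact/measurable_EFinP.
Qed.

Lemma integral_bigcup_le h F (c : nat -> R) (Z : R) :
  (forall j, measurable (F j)) -> trivIset setT F ->
  measurable_fun (\bigcup_j F j) h -> (forall t, (\bigcup_j F j) t -> 0 <= h t) ->
  (forall j, (\int[leb]_(t in F j) (h t)%:E <= (c j)%:E)%E) ->
  (forall n, \sum_(0 <= j < n) c j <= Z) ->
  (\int[leb]_(t in \bigcup_j F j) (h t)%:E <= Z%:E)%E.
Proof.
move=> mF tF mh h0 hc cZ; rewrite ge0_integral_bigcup//; last exact/measurable_EFinP.
have pos j : (0 <= \int[leb]_(t in F j) (h t)%:E)%E.
  by apply: integral_ge0 => t Ft; rewrite lee_fin h0//; exists j.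
apply: lime_le; first by apply: is_cvg_nneseries => j _ _; exact: pos.
apply: nearW => n; apply: (@le_trans _ _ (\sum_(0 <= j < n) (c j)%:E)%E).
  by apply: lee_sum => j _.
by rewrite sumEFin lee_fin.
Qed.

Lemma integral_bigcup_ge h F (c : nat -> R) n :
  (forall j, measurable (F j)) -> trivIset setT F ->
  measurable_fun (\bigcup_j F j) h -> (forall t, (\bigcup_j F j) t -> 0 <= h t) ->
  (forall j, ((c j)%:E <= \int[leb]_(t in F j) (h t)%:E)%E) ->
  ((\sum_(0 <= j < n) c j)%:E <= \int[leb]_(t in \bigcup_j F j) (h t)%:E)%E.
Proof.
move=> mF tF mh h0 hc; rewrite ge0_integral_bigcup//; last exact/measurable_EFinP.
rewrite -sumEFin (le_trans (lee_sum _ (fun j _ => hc j)))//.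
have pos j : (0 <= \int[leb]_(t in F j) (h t)%:E)%E.
  by apply: integral_ge0 => t Ft; rewrite lee_fin h0//; exists j.
by apply: nneseries_lim_ge => j *; exact: pos.
Qed.

End dyadic_integral.

(** * The interpolation norm as a sequence norm *)

Section interpolation_norm.
Context (R : realType) (H : hilbert R) (A : partial_op H) (rho theta : R).
Hypotheses (A_lin : linear_op A) (rho2 : 2 <= rho) (theta0 : 0 < theta).
Implicit Types (f : H) (t X Y M p : R) (q : \bar R) (b : nat -> R).
Local Notation K := (K_functional A).
Local Notation lam := (rho `^ theta).

Let rho0 : 0 < rho. Proof. by rewrite (lt_le_trans _ rho2). Qed.
Let rho1 : 1 <= rho. Proof. by rewrite (le_trans _ rho2)// ler1n. Qed.
Let rhoX0 j : 0 < rho ^+ j. Proof. by rewrite exprn_gt0. Qed.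
Let lam1 : 1 < lam.
Proof.
rewrite -[ltLHS](_ : 1 `^ theta = 1); last by rewrite powR1.
by rewrite gt0_ltr_powR ?nnegrE ?(ltW rho0)// (lt_le_trans _ rho2)// ltr1n.
Qed.

Let powR_geometricV j : (rho ^- j) `^ (- theta) = lam ^+ j.
Proof.
have -> : rho ^- j = rho `^ (- j%:R) by rewrite powRN powR_mulrn ?(ltW rho0).
by rewrite -powRrM mulrNN mulrC powRrM powR_mulrn// powR_ge0.
Qed.

Let powR_geometric j : (rho ^+ j) `^ (- theta) = lam ^- j.
Proof.
have -> : rho ^+ j = rho `^ j%:R by rewrite powR_mulrn ?(ltW rho0).
by rewrite -powRrM mulrN powRN mulrC powRrM powR_mulrn// powR_ge0.
Qed.

Let powRN_le s t : 0 < s -> s <= t -> t `^ (- theta) <= s `^ (- theta).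
Proof.
move=> s0 st; rewrite !powRN lef_pV2 ?posrE ?powR_gt0//; last exact: lt_le_trans st.
by rewrite ge0_ler_powR ?nnegrE ?(ltW theta0) ?(ltW s0)// (le_trans (ltW s0)).
Qed.

Let pos : set R := `]0, +oo[%classic.
Let low : set R := `]0, 1]%classic.
Let high : set R := `]1, +oo[%classic.

Let posE t : pos t = (0 < t). Proof. by rewrite /pos/= in_itv/= andbT. Qed.
Let lowE t : low t = (0 < t <= 1). Proof. by rewrite /low/= in_itv. Qed.
Let highE t : high t = (1 < t). Proof. by rewrite /high/= in_itv/= andbT. Qed.

Let integrand f p t := (t `^ (- theta) * K f t) `^ p / t.

Let integrand_ge0 f p t : 0 < t -> 0 <= integrand f p t.
Proof. by move=> t0; rewrite divr_ge0 ?powR_ge0 ?ltW. Qed.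

Let measurable_integrand f p : measurable_fun pos (integrand f p).
Proof.
pose K' t := K f (Num.max t 0).
have mK : measurable_fun setT K'.
  apply: nondecreasing_measurable => // s t st.
  apply: K_functional_nondecreasing => //; first by rewrite le_max lexx orbT.
  by rewrite ge_max !le_max st lexx !orbT.
have mG : measurable_fun setT (fun t => (t `^ (- theta) * K' t) `^ p * t `^ (- 1)).
  apply: measurable_funM => //.
  apply: (@measurableT_comp _ _ _ _ _ _ (@powR R ^~ p)) => //.
  by apply: measurable_funM.
apply: (eq_measurable_fun _ _ (measurable_funTS mG)) => t /set_mem.
rewrite posE => t0.
by rewrite /integrand /K' max_l ?ltW// powR_inv1// ltW.
Qed.

Let integrand_le f p t x y : 1 <= p -> 0 < x -> x <= t ->
  t `^ (- theta) * K f t <= y -> integrand f p t <= y `^ p / x.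
Proof.
move=> p1 x0 xt hy; have t0 := lt_le_trans x0 xt.
have k0 : 0 <= t `^ (- theta) * K f t.
  by rewrite mulr_ge0 ?powR_ge0 ?K_functional_ge0 ?(ltW t0).
rewrite /integrand ler_pM ?powR_ge0 ?invr_ge0 ?(ltW t0) ?lef_pV2 ?posrE//.
by rewrite ge0_ler_powR ?nnegrE// ?(le_trans ler01 p1)// (le_trans k0 hy).
Qed.

(** Up to [t = 1] the integral is a sum over the intervals between consecutive
    powers of [rho]; on [t > 1] the integrand is dominated by [K f 1] times a
    geometric series. *)
Lemma interp_norm_le q : (1 <= q)%E -> exists2 C : R, 0 < C & forall f X, 0 <= X ->
  lq_le q (fun j => lam ^+ j * K f (rho ^- j)) X ->
  (interp_norm A theta q f <= (C * X)%:E)%E.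
Proof.
have lam0 : 0 < lam by exact: lt_trans lam1.
have Kle f s t : 0 <= s -> s <= t -> K f s <= K f t by exact: K_functional_nondecreasing.
have K0 f t : 0 <= t -> 0 <= K f t by exact: K_functional_ge0.
have K1 f t : 0 <= t -> K f t <= K f 1 by exact: K_functional_le1.
have small f j t : rho ^- j.+1 < t -> t <= rho ^- j ->
    t `^ (- theta) * K f t <= lam * (lam ^+ j * K f (rho ^- j)).
  move=> jt tj; have s0 : 0 < rho ^- j.+1 by rewrite invr_gt0.
  have t0 := lt_trans s0 jt.
  rewrite mulrA -exprS -powR_geometricV ler_pM ?powR_ge0 ?K0 ?(ltW t0)//.
    by rewrite powRN_le// ltW.
  by rewrite Kle ?(ltW t0).
have large f j t : rho ^+ j < t -> t `^ (- theta) * K f t <= lam ^- j * K f 1.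
  move=> jt; have t0 := lt_trans (rhoX0 j) jt.
  by rewrite -powR_geometric ler_pM ?powR_ge0 ?K0 ?K1 ?(ltW t0)// powRN_le// ltW.
case: q => [p|_|//]; last first.
  exists lam => // f X X0 hX /=; apply: ub_ereal_sup => _ [t /= t0 <-].
  rewrite in_itv/= andbT in t0; rewrite lee_fin.
  have [t1|t1] := leP t 1.
    have : `]0, 1]%classic t by rewrite /= in_itv/= t0.
    rewrite -(bigcup_geometric_itvV rho2) => -[j _ /=].
    rewrite in_itv/= => /andP[jt tj]; rewrite (le_trans (small _ _ _ jt tj))//.
    by rewrite ler_wpM2l ?(ltW lam0).
  have := large f 0%N t; rewrite expr0 => /(_ t1); rewrite expr0 invr1 mul1r => h.
  have := hX 0%N; rewrite !expr0 mul1r invr1 => h2.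
  by rewrite (le_trans h)// (le_trans h2)// ler_peMl ?(ltW lam1).
rewrite lee_fin => p1; have p0 : 0 < p by lra.
pose mu := lam^-1 `^ p.
have mu0 : 0 <= mu by exact: powR_ge0.
have mu1 : mu < 1.
  rewrite (@le_lt_trans _ _ lam^-1)//; last by rewrite invf_lt1.
  by rewrite ge1r_powR// invr_gt0 lam0 invf_le1// ltW.
pose Z := lam `^ p * rho + rho / (1 - mu).
have Z0 : 0 < Z.
  by rewrite addr_gt0 ?mulr_gt0 ?powR_gt0 ?invr_gt0 ?subr_gt0 ?rho0.
exists (Z `^ p^-1); first exact: powR_gt0.
move=> f X X0 hX.
set I := (\int[lebesgue_measure]_(t in pos) (integrand f p t)%:E)%E.
have mU : measurable_fun pos (integrand f p) by exact: measurable_integrand.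
have sub1 : low `<=` pos.
  by move=> t; rewrite posE lowE => /andP[].
have sub2 : high `<=` pos.
  by move=> t; rewrite posE highE => /(lt_trans ltr01).
have mI : measurable pos by exact: measurable_itv.
have I1 : (\int[lebesgue_measure]_(t in low) (integrand f p t)%:E <=
    (lam `^ p * rho * X `^ p)%:E)%E.
  rewrite /low -(bigcup_geometric_itvV rho2).
  apply: (@integral_bigcup_le _ _ _ (fun j => lam `^ p * rho * (lam ^+ j * K f (rho ^- j)) `^ p)).
  - by move=> j; exact: measurable_itv.
  - apply: (trivIset_nonincreasing_itv (v := fun j => rho ^- j)) => i j ij.
    by rewrite lef_pV2 ?posrE// ler_weXn2l.
  - by rewrite bigcup_geometric_itvV//; exact: measurable_funS mU.
  - rewrite bigcup_geometric_itvV// -/low => t; rewrite lowE => /andP[t0 _].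
    exact: integrand_ge0.
  - move=> j; have jj : rho ^- j.+1 <= rho ^- j.
      by rewrite lef_pV2 ?posrE// ler_weXn2l.
    have subj : `]rho ^- j.+1, rho ^- j]%classic `<=` pos.
      move=> t /=; rewrite posE in_itv/= => /andP[+ _]; apply: lt_trans.
      by rewrite invr_gt0.
    apply: le_trans (integral_itv_le jj (measurable_funS mI subj mU) _) _.
      move=> t /andP[jt tj]; have t0 : 0 < t by rewrite (lt_trans _ jt)// invr_gt0.
      rewrite integrand_ge0//=.
      apply: (integrand_le p1 _ (ltW jt) (small _ _ _ jt tj)).
      by rewrite invr_gt0.
    rewrite lee_fin invrK powRM ?(ltW lam0)//; last first.
      by rewrite mulr_ge0 ?exprn_ge0 ?K0 ?invr_ge0 ?(ltW lam0) ?ltW.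
    have geo : rho ^+ j.+1 * (rho ^- j - rho ^- j.+1) = rho - 1.
      by rewrite mulrBr divff ?gt_eqF// exprS -mulrA divff ?gt_eqF// mulr1.
    rewrite -[leLHS]mulrA geo -!mulrA ler_wpM2l ?powR_ge0// mulrC.
    by rewrite ler_wpM2r ?powR_ge0// gerBl.
  - move=> n; rewrite -mulr_sumr; apply: ler_wpM2l; last exact: hX.
    by rewrite mulr_ge0 ?powR_ge0// ltW.
have I2 : (\int[lebesgue_measure]_(t in high) (integrand f p t)%:E <=
    (rho / (1 - mu) * X `^ p)%:E)%E.
  rewrite /high -(bigcup_geometric_itv rho2).
  apply: (@integral_bigcup_le _ _ _ (fun j => rho * K f 1 `^ p * mu ^+ j)).
  - by move=> j; exact: measurable_itv.
  - apply: (trivIset_nondecreasing_itv (v := fun j => rho ^+ j)) => i j ij.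
    by rewrite ler_weXn2l.
  - by rewrite bigcup_geometric_itv//; exact: measurable_funS mU.
  - rewrite bigcup_geometric_itv// -/high => t; rewrite highE => t1.
    by apply: integrand_ge0; exact: lt_trans t1.
  - move=> j; have jj : rho ^+ j <= rho ^+ j.+1 by rewrite ler_weXn2l.
    have subj : `]rho ^+ j, rho ^+ j.+1]%classic `<=` pos.
      by move=> t /=; rewrite posE in_itv/= => /andP[+ _]; apply: lt_trans.
    apply: le_trans (integral_itv_le jj (measurable_funS mI subj mU) _) _.
      move=> t /andP[jt tj]; have t0 : 0 < t by rewrite (lt_trans _ jt).
      rewrite integrand_ge0//=.
      by apply: (integrand_le p1 _ (ltW jt) (large _ _ _ jt)).
    rewrite lee_fin powRM ?invr_ge0 ?exprn_ge0 ?K0 ?(ltW lam0)//.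
    have geo : rho ^- j * (rho ^+ j.+1 - rho ^+ j) = rho - 1.
      by rewrite mulrBr mulVf ?gt_eqF// exprSr mulrA mulVf ?gt_eqF// mul1r.
    have -> : (lam ^- j) `^ p = mu ^+ j.
      rewrite -exprVn -[X in X `^ p]powR_mulrn ?invr_ge0 ?(ltW lam0)//.
      by rewrite powRAC powR_mulrn.
    rewrite -[leLHS]mulrA geo mulrC [mu ^+ j * _]mulrC mulrA.
    by rewrite ler_wpM2r ?exprn_ge0// ler_wpM2r ?powR_ge0// gerBl.
  - move=> n; rewrite -mulr_sumr.
    have k1 : K f 1 `^ p <= X `^ p.
      have := hX 1%N; rewrite big_nat1 !expr0 invr1 mul1r; exact.
    have geo : \sum_(0 <= i < n) mu ^+ i <= (1 - mu)^-1.
      rewrite -[leRHS]mul1r ler_pdivlMr ?subr_gt0// big_mkord.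
      by have := subrX1 mu n; have := exprn_ge0 n mu0; lra.
    rewrite mulrAC ler_pM ?powR_ge0//.
      by rewrite mulr_ge0 ?(ltW rho0)// sumr_ge0// => i _; rewrite exprn_ge0.
    by rewrite ler_wpM2l ?(ltW rho0).
have IX : (I <= (Z * X `^ p)%:E)%E.
  rewrite /I (_ : pos = low `|` high); last first.
    apply/seteqP; split=> [t|t []]; rewrite posE.
    - by move=> t0; case: (leP t 1) => h; [left; rewrite lowE t0|right; rewrite highE].
    - by rewrite lowE => /andP[].
    - by rewrite highE; exact: lt_trans.
  rewrite ge0_integral_setU//.
  - by rewrite /Z mulrDl EFinD leeD.
  - exact: measurable_itv.
  - exact: measurable_itv.
  - apply/measurable_EFinP; apply: measurable_funS mU => // t /= [|] /=.
      exact: sub1.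
    exact: sub2.
  - move=> t []; rewrite ?lowE ?highE => h; rewrite lee_fin integrand_ge0//.
      by case/andP: h.
    exact: lt_trans h.
  - rewrite disj_set2E; apply/eqP/seteqP; split => // t []; rewrite lowE highE.
    by move=> /andP[_ t1] /(le_lt_trans t1); rewrite ltxx.
rewrite [interp_norm _ _ _ _]/= -/I.
have -> : Z `^ p^-1 * X = (Z * X `^ p) `^ p^-1.
  by rewrite powRM ?powR_ge0 ?(ltW Z0)// -powRrM mulfV ?gt_eqF// powRr1.
rewrite -poweR_EFin; apply: ler_poweR2 IX; first by rewrite invr_ge0 ltW.
by apply: integral_ge0 => t; rewrite posE lee_fin; exact: integrand_ge0.
Qed.

(** On each interval between consecutive powers of [rho] the functional bounds
    [b j / M] from above, and the interval has mass at least [1 - rho^-1 >= 1/2]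
    for [dt / t]. *)
Lemma interp_norm_ge q f b M Y : (1 <= q)%E -> (forall j, 0 <= b j) -> 0 < M -> 0 <= Y ->
  (forall j t, rho ^- j.+1 <= t -> b j <= M * K f t) ->
  (interp_norm A theta q f <= Y%:E)%E ->
  lq_le q (fun j => lam ^+ j * b j) (2 * M * Y).
Proof.
move=> q1 b0 M0 Y0 bK; have lam0 : 0 < lam by exact: lt_trans lam1.
have MY : 0 <= M * Y by rewrite mulr_ge0 ?(ltW M0).
have jj j : rho ^- j.+1 <= rho ^- j by rewrite lef_pV2 ?posrE// ler_weXn2l.
have V0 j : 0 < rho ^- j by rewrite invr_gt0.
case: q q1 => [p p1|_|//]; last first.
  move=> /= nY j; have := bK j _ (jj j).
  move=> /(ler_wpM2l (exprn_ge0 j (ltW lam0))) h; rewrite (le_trans h)//.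
  apply: (@le_trans _ _ (M * Y)); last by lra.
  rewrite mulrCA ler_wpM2l ?(ltW M0)// -lee_fin; apply: le_trans nY.
  rewrite -powR_geometricV; apply: ereal_sup_ubound; exists (rho ^- j) => //=.
  by rewrite in_itv/= V0.
rewrite lee_fin in p1; have p0 : 0 < p by rewrite (lt_le_trans _ p1).
rewrite [interp_norm _ _ _ _]/=.
set I := (\int[lebesgue_measure]_(t in pos) (integrand f p t)%:E)%E => nY n.
have mU : measurable_fun pos (integrand f p) by exact: measurable_integrand.
have mI : measurable pos by exact: measurable_itv.
have I0 : (0 <= I)%E.
  by apply: integral_ge0 => t; rewrite posE lee_fin; exact: integrand_ge0.
have IY : (I <= (Y `^ p)%:E)%E.
  have -> : I = poweR (poweR I p^-1) p by rewrite -poweRrM mulVf ?gt_eqF// poweRe1.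
  by rewrite -poweR_EFin; apply: ler_poweR2 => //; [exact: ltW|exact: poweR_ge0].
pose c j := ((lam ^+ j * b j) / M) `^ p / 2.
have cI : ((\sum_(0 <= j < n) c j)%:E <= I)%E.
  apply: (@le_trans _ _ (\int[lebesgue_measure]_(t in low) (integrand f p t)%:E)%E); last first.
    apply: ge0_subset_integral => //.
    - exact: measurable_itv.
    - exact/measurable_EFinP.
    - by move=> t; rewrite posE lee_fin; exact: integrand_ge0.
    - by move=> t; rewrite lowE posE => /andP[].
  rewrite /low -(bigcup_geometric_itvV rho2); apply: integral_bigcup_ge.
  - by move=> j; exact: measurable_itv.
  - apply: (trivIset_nonincreasing_itv (v := fun j => rho ^- j)) => i j ij.
    by rewrite lef_pV2 ?posrE// ler_weXn2l.
  - rewrite bigcup_geometric_itvV// -/low; apply: measurable_funS mU => // t.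
    by rewrite lowE posE => /andP[].
  - rewrite bigcup_geometric_itvV// -/low => t; rewrite lowE => /andP[t0 _].
    exact: integrand_ge0.
  - move=> j; have subj : `]rho ^- j.+1, rho ^- j]%classic `<=` pos.
      by move=> t /=; rewrite posE in_itv/= => /andP[+ _]; apply: lt_trans.
    apply: (le_trans _ (integral_itv_ge (c := ((lam ^+ j * b j) / M) `^ p * rho ^+ j)
      (jj j) _ (measurable_funS mI subj mU) _)).
    + rewrite lee_fin /c -[leRHS]mulrA ler_wpM2l ?powR_ge0//.
      have -> : rho ^+ j * (rho ^- j - rho ^- j.+1) = 1 - rho^-1.
        rewrite mulrBr divff ?gt_eqF// exprSr invfM mulrA [X in 1 - X]mulrAC.
        by rewrite mulrC mulrA mulVf ?gt_eqF// mul1r.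
      have : rho^-1 <= 2^-1 by rewrite lef_pV2 ?posrE.
      lra.
    + by rewrite mulr_ge0 ?powR_ge0// ltW.
    + move=> t /andP[jt tj]; have t0 := lt_trans (V0 j.+1) jt.
      rewrite /integrand ler_pM ?powR_ge0 ?(ltW (rhoX0 _))//; last first.
        by rewrite -[rho ^+ j]invrK lef_pV2 ?posrE.
      have lb : 0 <= lam ^+ j * b j / M.
        by rewrite !mulr_ge0 ?exprn_ge0 ?invr_ge0 ?(ltW M0) ?(ltW lam0).
      have le : lam ^+ j * b j / M <= t `^ (- theta) * K f t.
        rewrite -mulrA -powR_geometricV ler_pM ?powR_ge0 ?powRN_le//.
          by rewrite mulr_ge0 ?invr_ge0 ?b0 ?(ltW M0).
        by rewrite ler_pdivrMr// mulrC bK// ltW.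
      by rewrite ge0_ler_powR ?nnegrE ?(ltW p0)// (le_trans lb).
have : \sum_(0 <= j < n) c j <= Y `^ p by rewrite -lee_fin (le_trans cI).
rewrite -mulr_suml ler_pdivrMr// => h.
have two : 2 <= 2 `^ p :> R by rewrite -[leLHS]powRr1// ler_powR// ler1n.
rewrite /= -mulrA powRM// ?(ltW M0)// powRM ?(ltW M0)//.
apply: (@le_trans _ _ (M `^ p * (Y `^ p * 2))).
  apply: le_trans (ler_wpM2l (powR_ge0 _ _) h); rewrite mulr_sumr.
  apply: ler_sum => j _; rewrite -powRM ?(ltW M0)//; last first.
    by rewrite !mulr_ge0 ?exprn_ge0 ?invr_ge0 ?(ltW M0) ?(ltW lam0).
  by rewrite [M * _]mulrC divfK ?gt_eqF.
by rewrite mulrA mulrC ler_wpM2r// mulr_ge0 ?powR_ge0.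
Qed.

End interpolation_norm.

(** * The norm equivalence *)

Lemma lq_norm_ge0 (R : realType) (q : \bar R) (c : nat -> R) :
  (0 <= lq_norm q c)%E.
Proof.
case: q => [p||] //=; first exact: poweR_ge0.
by apply: (@le_trans _ _ `|c 0%N|%:E) => //; apply: ereal_sup_ubound; exists 0%N.
Qed.

Lemma interp_norm_ge0 (R : realType) (H : hilbert R) (A : partial_op H)
    (theta : R) (q : \bar R) (f : H) :
  linear_op A -> (0 <= interp_norm A theta q f)%E.
Proof.
move=> A_lin; case: q => [p||] //=; first exact: poweR_ge0.
apply: (@le_trans _ _ (1 `^ (- theta) * K_functional A f 1)%:E).
  by rewrite lee_fin mulr_ge0 ?powR_ge0 ?K_functional_ge0.
by apply: ereal_sup_ubound; exists 1 => //=; rewrite in_itv/= ltr01.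
Qed.

Theorem theorem7p6 (R : realType) (H : hilbert R) (L sqrtL : partial_op H)
    (E : pvm H) (g : R -> R) (alpha : R) (q : \bar R) (r : nat)
    (L_sa : self_adjoint L) (L_pos : positive_definite L)
    (sqrtL_def : is_positive_sqrt L sqrtL)
    (E_sqrtL : is_spectral_measure sqrtL E)
    (g_cutoff : cutoff g)
    (alpha_gt0 : 0 < alpha) (alpha_lt_r : alpha < r%:R) (q_ge1 : (1 <= q)%E) :
  exists c C : R, [/\ 0 < c, 0 < C &
    forall f : H,
      let disc_norm := lq_norm q (fun j : nat =>
        2 `^ (j%:R * alpha) * hnorm (spectral_op E (LP_fun g j) f)) in
      (c%:E * disc_norm <= besov_norm sqrtL r alpha q f)%E /\
      (besov_norm sqrtL r alpha q f <= C%:E * disc_norm)%E].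
Proof.
have [[S_lin _ _] S_nonneg _] := sqrtL_def.
have A_lin := op_pow_linear S_lin r.
have r0 : 0 < r%:R :> R by exact: lt_trans alpha_lt_r.
pose rho : R := 2 ^+ r; pose lam : R := 2 `^ alpha.
have rho2 : 2 <= rho.
  by rewrite -[leLHS]expr1 ler_weXn2l ?ler1n// -(ltr0n R).
have powR2_gt1 s : 0 < s -> 1 < 2 `^ s :> R.
  move=> s0; rewrite -[ltLHS](_ : 1 `^ s = 1); last by rewrite powR1.
  by rewrite gt0_ltr_powR ?nnegrE// ltr1n.
have lam_gt1 : 1 < lam by exact: powR2_gt1.
have lam_lt : lam < rho.
  rewrite /rho -powR_mulrn// -(subrKC alpha r%:R) powRD; last by rewrite pnatr_eq0 implybT.
  by rewrite ltr_pMr ?powR_gt0// powR2_gt1// subr_gt0.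
have lamE : rho `^ (alpha / r%:R) = lam.
  by rewrite /rho -powR_mulrn// -powRrM mulrC divfK// gt_eqF.
have bE f : (fun j : nat => 2 `^ (j%:R * alpha) * hnorm (spectral_op E (LP_fun g j) f)) =
    (fun j => lam ^+ j * hnorm (spectral_op E (LP_fun g j) f)).
  by apply/funext => j; rewrite [j%:R * _]mulrC powRrM powR_mulrn ?powR_ge0.
have theta0 : 0 < alpha / r%:R by rewrite divr_gt0.
have [A A0 hA] := lq_le_K_dyadic S_lin S_nonneg E_sqrtL q_ge1 lam_gt1 lam_lt.
have [B B0 hB] := interp_norm_le A_lin rho2 theta0 q_ge1.
(* On the first of the two pieces that carry F_j, one factor rho is lost because
   t may be as small as rho^-(j+1), another one because the piece reaches down
   to 2^(j-1); the second piece is better by a factor rho. *)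
pose M := rho * rho + rho * rho.
have rho0 : 0 < rho by rewrite (lt_le_trans _ rho2).
have M0 : 0 < M by rewrite addr_gt0// mulr_gt0.
have lam0 : 0 < lam by rewrite (lt_trans _ lam_gt1).
exists (2 * M)^-1, (B * (A * (4 * (1 + lam)))); split.
- by rewrite invr_gt0 mulr_gt0.
- by rewrite !mulr_gt0// addr_gt0.
move=> f N; have {}NE : N = lq_norm q (fun j => lam ^+ j *
    hnorm (spectral_op E (LP_fun g j) f)) by rewrite /N bE.
have b0 j : 0 <= lam ^+ j * hnorm (spectral_op E (LP_fun g j) f).
  by apply: mulr_ge0; [apply: exprn_ge0; exact: ltW|exact: hnorm_ge0].
rewrite /besov_norm; split.
  have := interp_norm_ge0 (alpha / r%:R) q f A_lin.
  case BE : (interp_norm _ _ _ _) => [Y| |//]; last by move=> _; rewrite leey.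
  rewrite lee_fin => Y0.
  have NY : (N <= (2 * M * Y)%:E)%E.
    have MY : 0 <= 2 * M * Y by rewrite !mulr_ge0// ltW.
    rewrite NE; apply/(lq_norm_le q_ge1 b0 MY); rewrite -lamE.
    have IY : (interp_norm (op_pow sqrtL r) (alpha / r%:R) q f <= Y%:E)%E by rewrite BE.
    apply: (interp_norm_ge A_lin rho2 theta0 q_ge1 _ M0 Y0 _ IY).
      by move=> j; exact: hnorm_ge0.
    move=> j t tj; have t0 : 0 <= t.
      by apply: le_trans tj; rewrite invr_ge0 exprn_ge0// ltW.
    have c1 : 1 <= rho * rho by rewrite mulr_ege1//; lra.
    have ct k : (j <= k)%N -> rho <= rho * rho * t * rho ^+ k.
      move=> jk; apply: (@le_trans _ _ (rho * rho * rho ^- j.+1 * rho ^+ j)).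
        rewrite exprS invfM -!mulrA mulVf ?mulr1 ?expf_neq0 ?gt_eqF//.
        by rewrite divff ?mulr1// gt_eqF.
      apply: ler_pM; rewrite ?mulr_ge0 ?invr_ge0 ?exprn_ge0 ?(ltW rho0)//.
        by rewrite ler_wpM2l// mulr_ge0// ltW.
      by rewrite ler_weXn2l//; lra.
    rewrite (le_trans (LP_le_dyadic E g_cutoff j f))// mulrDl lerD//.
      exact: (dyadic_le_K S_lin E_sqrtL _ t0 c1 (ct _ (leqnn j))).
    exact: (dyadic_le_K S_lin E_sqrtL _ t0 c1 (ct _ (leqnSn j))).
  have M2 : 0 < 2 * M by rewrite mulr_gt0.
  apply: (@le_trans _ _ ((2 * M)^-1%:E * (2 * M * Y)%:E)%E).
    by rewrite lee_pmul2l// lte_fin invr_gt0.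
  by rewrite -EFinM mulKf// gt_eqF.
have : (0 <= N)%E by exact: lq_norm_ge0.
case NX : N => [X| |//]; last first.
  by move=> _; rewrite gt0_muley ?leey// lte_fin !mulr_gt0// addr_gt0.
rewrite lee_fin => X0.
have aX : lq_le q (fun j => lam ^+ j * hnorm (spectral_op E (LP_fun g j) f)) X.
  by apply/(lq_norm_le q_ge1 b0 X0); rewrite -NE NX.
have dX := lq_le_dyadic g_cutoff q_ge1 lam_gt1 X0 aX.
have X10 : 0 <= 4 * (X + lam * X) by rewrite mulr_ge0// addr_ge0// mulr_ge0// ltW.
have kX := hA f _ X10 dX.
rewrite -lamE in kX.
have AX0 : 0 <= A * (4 * (X + lam * X)) by rewrite mulr_ge0// ltW.
have := hB f _ AX0; rewrite lamE in kX *; move=> /(_ kX) h.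
rewrite (le_trans h)// -EFinM lee_fin le_eqVlt; apply/orP; left; apply/eqP; ring.
Qed.
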